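(* Let $A,B,C,D$ be $n\times n$ complex positive definite matrices and let $p\ge 1$ and $r\ge 1$. Then for every unitarily invariant norm $|||\cdot|||$ on the space of $n\times n$ complex matrices, $$\left|\left|\left|\left(A^{2}\sharp B^{2}\right)^{r}+\left(C^{2}\sharp D^{2}\right)^{r}\right|\right|\right|\le \left|\left|\left|\left((A+C)^{\frac{rp}{2}}(B+D)^{rp}(A+C)^{\frac{rp}{2}}\right)^{\frac1p}\right|\right|\right|.$$
   Context: For positive definite $n\times n$ complex matrices $X,Y$, the geometric mean is $X\sharp Y=X^{1/2}\left(X^{-1/2}YX^{-1/2}\right)^{1/2}X^{1/2}$. A norm $|||\cdot|||$ on $n\times n$ complex matrices is unitarily invariant if $|||UXV|||=|||X|||$ for all matrices $X$ and all unitary $U,V$. Real powers of positive definite matrices are defined by the functional calculus. *)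

(* Defs.v *)
(* Complex numbers are [R[i]] with R : realType. *)
From mathcomp Require Export all_boot all_order all_algebra.
From mathcomp Require Export reals exp.
From mathcomp Require Export complex.

Set Implicit Arguments.
Unset Strict Implicit.
Unset Printing Implicit Defensive.

Import Order.TTheory GRing.Theory Num.Theory.
Local Open Scope ring_scope.
Local Open Scope sesquilinear_scope.
Local Open Scope complex_scope.

(* On [R[i]], [0 < z] means that z is real and positive. *)
Definition posdefmx (R : realType) (n : nat) (A : 'M[R[i]]_n) : Prop :=
  A \is hermsymmx /\
  forall x : 'cV[R[i]]_n, x != 0 -> 0 < (x ^t* *m A *m x) 0 0.

(* Functional calculus f(A) = P^* f(Lambda) P for A = P^* Lambda P with P unitary
   and Lambda real diagonal. [spectralmx]/[spectral_diag] provide such a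
   decomposition when A is Hermitian (the result does not depend on its choice);
   for non-normal A they are default values and [funmx f A] is meaningless. *)
Definition funmx (R : realType) (n : nat) (f : R -> R) (A : 'M[R[i]]_n) :
    'M[R[i]]_n :=
  (spectralmx A) ^t*
    *m diag_mx (map_mx (fun z : R[i] => (f (complex.Re z))%:C) (spectral_diag A))
    *m spectralmx A.

Definition powmx (R : realType) (n : nat) (A : 'M[R[i]]_n) (s : R) :
    'M[R[i]]_n :=
  funmx (fun x : R => powR x s) A.

Definition geomean (R : realType) (n : nat) (X Y : 'M[R[i]]_n) : 'M[R[i]]_n :=
  powmx X (1 / 2)
    *m powmx (powmx X (- (1 / 2)) *m Y *m powmx X (- (1 / 2))) (1 / 2)
    *m powmx X (1 / 2).

(* Norm axioms on the complex vector space of matrices; nonnegativity and N 0 = 0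
   follow from these. [ComplexField.Normc.normc z] is the R-valued modulus of z. *)
Record mxnorm (R : realType) (n : nat) (N : 'M[R[i]]_n -> R) : Prop := {
  mxnorm_definite : forall X, N X = 0 -> X = 0;
  mxnorm_homogeneous : forall (z : R[i]) X,
    N (z *: X) = ComplexField.Normc.normc z * N X;
  mxnorm_triangle : forall X Y, N (X + Y) <= N X + N Y
}.

Definition unitarily_invariant (R : realType) (n : nat)
    (N : 'M[R[i]]_n -> R) : Prop :=
  forall U V X : 'M[R[i]]_n,
    U \is unitarymx -> V \is unitarymx -> N (U *m X *m V) = N X.

(* Main.v *)
From HB Require Import structures.
Require Import Defs.
From mathcomp Require Import all_boot all_order all_algebra.
From mathcomp Require Import perm spectral sesquilinear.
From mathcomp Require Import reals exp complex.
From mathcomp Require Import ring lra zify.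

(** Write P = A + C, Q = B + D, and let G, H be the geometric means of (A, B) and
    of (C, D), X and Y those of (A^2, B^2) and of (C^2, D^2). A unitarily invariant
    norm of a positive definite matrix is a symmetric gauge function of its
    eigenvalues, so by Ky Fan dominance ([Fan_dominance]) it is enough to compare,
    for every k, the sums of the k largest eigenvalues of the two sides. This is
    done along the chain, in which l denotes the decreasing list of eigenvalues,

      l(X^r + Y^r) <  l(X + Y)^r <  l(G + H)^(2r) << l(P^(1/2) Q P^(1/2))^r
                   << l((P^(rp/2) Q^(rp) P^(rp/2))^(1/p)),

    where < compares sums of leading terms and << compares products of leading
    terms. The latter implies the former ([logmaj_sum]), and the former is
    preserved by powers with exponent at least one ([submaj_powR]).

    The first two steps have the same shape ([sum_eigs_congr]): a sum X^(1/2) K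
    X^(1/2) + Y^(1/2) L Y^(1/2) is J^H diag(K, L) J, where J stacks the two
    square roots. As J^H J = X + Y, the Horn inequality ([eigprod_Horn]) bounds
    its eigenvalues by products of those of X + Y and of diag(K, L), and the
    eigenvalues of diag(X, Y) are dominated by those of X + Y
    ([sum_eigs_bdiag]). For the first step K and L are X^(r-1) and Y^(r-1). For
    the second one G and H take the place of X and Y under the square roots,
    with X = G^(1/2) K G^(1/2), and the Riccati equations G A^(-1) G = B and X
    A^(-2) X = B^2 show that K is similar to a matrix T with T^H T = G^2; the
    Weyl inequality between eigenvalues and singular values ([eigprod_Weyl])
    then gives l(K) << l(G) ([eigprod_Riccati_sqr]).

    The third step ([eigprod_Riccati_sum]) rests on the joint convexity of
    (G, A) to G A^(-1) G, which yields (G + H) P^(-1) (G + H) <= Q, and again on the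
    Weyl and Horn inequalities. The last one is the Araki inequality with exponent
    r p >= 1 ([Araki]), obtained from the log-convexity of the eigenvalue products
    of P^(t/2) Q^t P^(t/2) as functions of t.

    Exterior powers are avoided throughout: the product of the k largest
    eigenvalues of A is the best constant in det (V^H A V) <= c det (V^H V) for
    matrices V with k columns ([det_compression_le]), a direct consequence of the
    Cauchy-Binet formula. *)

Set Implicit Arguments.
Unset Strict Implicit.
Unset Printing Implicit Defensive.

Import Order.TTheory GRing.Theory Num.Theory.
Local Open Scope ring_scope.
Local Open Scope sesquilinear_scope.
Local Open Scope complex_scope.

(** * Majorization of real sequences *)

Section RealSequences.
Variable R : realType.
Implicit Types (c d x y z w : nat -> R) (n k : nat) (r s : R).

(** Only the first [n] terms matter: an ordered spectrum of an n x n matrix is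
    a sequence indexed by [nat], so that prefix sums and products need no casts. *)
Definition decpos n d :=
  (forall i, (i < n)%N -> 0 < d i) /\
  (forall i j, (i <= j)%N -> (j < n)%N -> d j <= d i).

(** Summation by parts, in a form that passes through an induction on [k]: the
    lower bound [e] becomes the new last coefficient [c k]. *)
Lemma Abel_ge c z k :
  (forall i j, (i <= j)%N -> (j < k)%N -> c j <= c i) ->
  (forall l, (l <= k)%N -> 0 <= \sum_(j < l) z j) ->
  forall e, (forall j, (j < k)%N -> e <= c j) ->
  e * \sum_(j < k) z j <= \sum_(j < k) c j * z j.
Proof.
elim: k => [|k IH] cdec zge e ec; first by rewrite !big_ord0 mulr0.
apply: (@le_trans _ _ (c k * \sum_(j < k.+1) z j)).
  by apply: ler_wpM2r; [apply: zge | apply: ec].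
rewrite !big_ord_recr /= mulrDr lerD2r; apply: IH.
- by move=> i j ij jk; apply: cdec => //; apply: ltnW.
- by move=> l lk; apply: zge; apply: leqW.
- by move=> j jk; apply: cdec => //; apply: ltnW.
Qed.

Lemma Abel_ge0 c z k : decpos k c ->
  (forall l, (l <= k)%N -> 0 <= \sum_(j < l) z j) ->
  0 <= \sum_(j < k) c j * z j.
Proof.
move=> [cpos cdec] zge.
by have := Abel_ge cdec zge (e := 0); rewrite mul0r; apply=> j /cpos/ltW.
Qed.

Lemma decposW n k d : (k <= n)%N -> decpos n d -> decpos k d.
Proof.
move=> kn [dp dd]; split=> [i ik|i j ij jk]; first exact/dp/(leq_trans ik).
by apply: dd => //; apply: leq_trans kn.
Qed.

Lemma decpos_powR n d s : 0 <= s -> decpos n d -> decpos n (fun j => powR (d j) s).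
Proof.
move=> s0 [dp dd]; split=> [i ik|i j ij jk]; first by rewrite powR_gt0 ?dp.
have jp := dp _ jk; have ip := dp _ (leq_ltn_trans ij jk).
by apply: ge0_ler_powR; rewrite ?nnegrE ?(dd i j) // ltW.
Qed.

Lemma prod_powR k d s : (forall j, (j < k)%N -> 0 < d j) ->
  powR (\prod_(j < k) d j) s = \prod_(j < k) powR (d j) s.
Proof.
elim: k => [|k IH] dp; first by rewrite !big_ord0 powR1.
rewrite !big_ord_recr /= powRM ?IH // => [j jk||]; first by apply: dp; apply: ltnW.
  by apply: prodr_ge0 => i _; apply/ltW/dp/leqW.
exact/ltW/dp.
Qed.

Lemma ln_prod k d : (forall j, (j < k)%N -> 0 < d j) ->
  ln (\prod_(j < k) d j) = \sum_(j < k) ln (d j).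
Proof.
elim: k => [|k IH] dp; first by rewrite !big_ord0 ln1.
rewrite !big_ord_recr /= lnM ?IH // ?posrE; first by move=> j jk; apply: dp; apply: ltnW.
  by apply: prodr_gt0 => i _; apply/dp/leqW.
exact: dp.
Qed.

(** From y >= x + x ln (y / x), which is 1 + u <= exp u in disguise, the
    difference of the two sums is at least a sum of ln (y / x) with decreasing
    weights x, and the prefix sums of ln (y / x) are nonnegative. *)
Lemma logmaj_sum k x y : decpos k x -> (forall j, (j < k)%N -> 0 < y j) ->
  (forall l, (l <= k)%N -> \prod_(j < l) x j <= \prod_(j < l) y j) ->
  \sum_(j < k) x j <= \sum_(j < k) y j.
Proof.
move=> xd yp xy; have [xp _] := xd; rewrite -subr_ge0 -sumrB.
apply: (@le_trans _ _ (\sum_(j < k) x j * (ln (y j) - ln (x j)))).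
  apply: (@Abel_ge0 x (fun j => ln (y j) - ln (x j))) => // l lk.
  rewrite sumrB subr_ge0 -!ln_prod; last 2 first.
  - by move=> j jl; apply: yp; apply: leq_trans lk.
  - by move=> j jl; apply: xp; apply: leq_trans lk.
  rewrite ler_ln ?posrE ?xy //; apply: prodr_gt0 => i _.
    exact/xp/(leq_trans _ lk).
  exact/yp/(leq_trans _ lk).
apply: ler_sum => j _.
have xj := xp j (ltn_ord j); have yj := yp j (ltn_ord j).
rewrite -ln_div ?posrE //.
have -> : y j - x j = x j * (y j / x j - 1).
  by rewrite mulrBr mulr1 mulrCA divff ?mulr1 ?gt_eqF.
rewrite ler_pM2l //.
have := @le_ln1Dx R (y j / x j - 1).
by rewrite (addrC 1) subrK; apply; rewrite ltrBDr addNr divr_gt0.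
Qed.

(** The graph of a convex power lies above its tangent at [a]. For r > 1 this is
    the Young inequality for [b] and the power r - 1 of [a], with conjugate
    exponents r and r / (r - 1). *)
Lemma powR_tangent r (a b : R) : 1 <= r -> 0 < a -> 0 < b ->
  r * powR a (r - 1) * (b - a) <= powR b r - powR a r.
Proof.
move=> r1 a0 b0; have r0 : 0 < r by lra.
have -> : powR a r = a * powR a (r - 1) by rewrite mulr_powRB1 // ltW.
have [->|rn1] := eqVneq r 1.
  by rewrite subrr powRr0 !mulr1 mul1r powRr1 // ltW.
have s0 : 0 < r - 1 by rewrite subr_gt0 lt_neqAle eq_sym rn1.
have := @conjugate_powR R b (powR a (r - 1)) r (r / (r - 1)) (ltW b0) (powR_ge0 _ _) r0.
rewrite divr_gt0 // invf_div => /(_ isT).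
have -> : r^-1 + (r - 1) / r = 1 by field; rewrite gt_eqF.
move/(_ erefl); rewrite -powRrM.
have -> : (r - 1) * (r / (r - 1)) = r by field; rewrite gt_eqF.
have -> : powR a r = a * powR a (r - 1) by rewrite mulr_powRB1 // ltW.
move: (powR b r) (powR a (r - 1)) => B t H.
have : r * (b * t) <= r * (B / r + a * t * ((r - 1) / r)) by rewrite ler_pM2l.
have -> : r * (B / r + a * t * ((r - 1) / r)) = B + a * t * (r - 1).
  by field; rewrite gt_eqF.
lra.
Qed.

(** The tangent inequality reduces the claim to summation by parts with the
    decreasing weights given by the powers r - 1 of [x]. *)
Lemma submaj_powR k r x y : 1 <= r -> decpos k x ->
  (forall j, (j < k)%N -> 0 < y j) ->
  (forall l, (l <= k)%N -> \sum_(j < l) x j <= \sum_(j < l) y j) ->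
  \sum_(j < k) powR (x j) r <= \sum_(j < k) powR (y j) r.
Proof.
move=> r1 xd yp xy; rewrite -subr_ge0 -sumrB.
apply: (@le_trans _ _ (\sum_(j < k) powR (x j) (r - 1) * (r * (y j - x j)))).
  apply: (@Abel_ge0 (fun j => powR (x j) (r - 1)) (fun j => r * (y j - x j))).
    by apply: decpos_powR; rewrite ?subr_ge0.
  move=> l lk; rewrite -mulr_sumr sumrB mulr_ge0 ?subr_ge0 ?xy //; lra.
case: xd => xp _; apply: ler_sum => j _.
by rewrite mulrCA mulrA powR_tangent ?xp ?yp.
Qed.

(** The termwise difference w^(1+s) - w a^s is at least s a^s (w - a): this is
    the tangent inequality with exponent 1 + s, rearranged. The weights a^s
    decrease, so summation by parts concludes. This covers exponents [s] smaller
    than one, where t^s is not convex. *)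
Lemma submaj_weighted_powR k s a w : 0 <= s -> decpos k a ->
  (forall j, (j < k)%N -> 0 < w j) ->
  (forall l, (l <= k)%N -> \sum_(j < l) a j <= \sum_(j < l) w j) ->
  \sum_(j < k) w j * powR (a j) s <= \sum_(j < k) powR (w j) (1 + s).
Proof.
move=> s0 ad wp aw; rewrite -subr_ge0 -sumrB.
apply: (@le_trans _ _ (\sum_(j < k) powR (a j) s * (s * (w j - a j)))).
  apply: (@Abel_ge0 (fun j => powR (a j) s) (fun j => s * (w j - a j))).
    exact: decpos_powR.
  by move=> l lk; rewrite -mulr_sumr sumrB mulr_ge0 ?subr_ge0 ?aw.
case: ad => ap _; apply: ler_sum => j _.
have aj := ap j (ltn_ord j); have wj := wp j (ltn_ord j).
have := @powR_tangent (1 + s) (a j) (w j) _ aj wj.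
rewrite lerDl s0 => /(_ isT).
have -> : 1 + s - 1 = s by lra.
have -> : powR (a j) (1 + s) = a j * powR (a j) s.
  by rewrite -[LHS]mulr_powRB1 ?ltW //; [congr (_ * powR _ _); lra | lra].
move: (powR (a j) s) (powR (w j) (1 + s)) => t B; lra.
Qed.

(** Every point of [0, q] is the midpoint of an endpoint, where [f] is
    nonpositive, and of another point of the interval. So an upper bound for [f]
    can be halved again and again. *)
Lemma midconvex_le0 (f : R -> R) (q B : R) :
  f 0 <= 0 -> f q <= 0 ->
  (forall a b, f ((a + b) / 2) <= (f a + f b) / 2) ->
  (forall t, 0 <= t <= q -> f t <= B) ->
  forall t, 0 <= t <= q -> f t <= 0.
Proof.
move=> f0 fq fmid fB t tq.
have B0 : 0 <= Num.max B 0 by rewrite le_max lexx orbT.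
have step m : forall t, 0 <= t <= q -> f t <= Num.max B 0 / 2 ^+ m.
  elim: m => [|m IH] u uq; first by rewrite expr0 divr1 le_max fB.
  have -> : Num.max B 0 / 2 ^+ m.+1 = Num.max B 0 / 2 ^+ m / 2.
    by rewrite exprSr invfM mulrA.
  have [uh|uh] := leP u (q / 2).
    have := fmid 0 (2 * u); have -> : (0 + 2 * u) / 2 = u by lra.
    move=> /le_trans; apply; have : f (2 * u) <= Num.max B 0 / 2 ^+ m by apply: IH; lra.
    lra.
  have := fmid (2 * u - q) q; have -> : (2 * u - q + q) / 2 = u by lra.
  move=> /le_trans; apply.
  have : f (2 * u - q) <= Num.max B 0 / 2 ^+ m by apply: IH; lra.
  lra.
rewrite leNgt; apply/negP => ft.
have := @upper_nthrootP _ (Num.max B 0 / f t) _ (leqnn _).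
rewrite ltr_pdivrMr //; set m := Num.bound _ => hlt; have := step m t tq.
by rewrite ler_pdivlMr ?exprn_gt0 // leNgt mulrC hlt.
Qed.

End RealSequences.

(** * The Cauchy-Binet formula *)

Section CauchyBinet.
Variable F : comNzRingType.

Lemma det_mulmx_rect k m (A : 'M[F]_(k, m)) (B : 'M[F]_(m, k)) :
  \det (A *m B) = \sum_(g : {ffun 'I_k -> 'I_m})
    (\prod_i A i (g i)) * \det (rowsub g B).
Proof.
pose AB (s : 'S_k) i j := A i j * B j (s i).
transitivity (\sum_(g : {ffun 'I_k -> 'I_m})
    \sum_(s : 'S_k) (-1) ^+ s * \prod_i AB s i (g i)).
  rewrite exchange_big; apply: eq_bigr => /= s _; rewrite -big_distrr /=.
  congr (_ * _); rewrite -(bigA_distr_bigA (AB s)) /=.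
  by apply: eq_bigr => x _; rewrite mxE.
apply: eq_bigr => g _; rewrite big_distrr /=; apply: eq_bigr => s _.
rewrite mulrCA big_split //=; congr (_ * (_ * _)).
by apply: eq_bigr => x _; rewrite mxE.
Qed.

(** Indexing by all functions rather than by k-subsets counts every minor k!
    times and removes any need to order the index sets; the non-injective
    functions contribute zero. *)
Lemma Cauchy_Binet k m (A : 'M[F]_(k, m)) (B : 'M[F]_(m, k)) :
  \sum_(g : {ffun 'I_k -> 'I_m}) \det (colsub g A) * \det (rowsub g B)
  = k`!%:R * \det (A *m B).
Proof.
transitivity (\sum_(s : 'S_k) \det (A *m B)); last first.
  by rewrite sumr_const mulr_natl -card_Sn.
under eq_bigr => g _ do rewrite big_distrl /=.
rewrite exchange_big /=; apply: eq_bigr => s _; rewrite det_mulmx_rect.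
pose h (t : 'S_k) (g : {ffun 'I_k -> 'I_m}) := [ffun i => g (t i)] : {ffun _ -> _}.
have hK t : cancel (h t) (h t^-1%g).
  by move=> g; apply/ffunP => i; rewrite !ffunE permKV.
rewrite (reindex_inj (can_inj (hK s^-1%g))) /=; apply: eq_bigr => g _.
have -> : rowsub (h s^-1%g g) B = row_perm s^-1%g (rowsub g B).
  by apply/matrixP => i j; rewrite !mxE ffunE.
rewrite row_permE det_mulmx det_perm odd_permV.
have -> : \prod_i colsub (h s^-1%g g) A i (s i) = \prod_i A i (g i).
  by apply: eq_bigr => i _; rewrite !mxE ffunE permK.
by rewrite mulrACA -signr_odd; case: odd; rewrite /= ?expr0 ?expr1; ring.
Qed.

End CauchyBinet.

(** * Selections of the largest terms of a decreasing sequence *)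

Section TopWeights.
Variable R : realType.

(** Divide all terms by the k-th one: the first [k] become at least one, the
    others at most one. Hence the product over any selection is at most the
    product of the maxima of 1 and the quotients over all indices, which is the
    product of the first [k] quotients. *)
Lemma prod_inj_le m k (d : nat -> R) (g : 'I_k -> 'I_m) :
  injective g -> decpos m d ->
  \prod_(i < k) d (g i) <= \prod_(i < k) d i.
Proof.
case: k g => [|k] g gI [dp dd]; first by rewrite !big_ord0.
have km : (k < m)%N.
  by have := leq_card g gI; rewrite !card_ord.
(* [k] is already the predecessor: [d k] is the last of the k.+1 top terms. *)
pose f j := Num.max (d j / d k) 1.
have dk := dp _ km.
have f1 j : 1 <= f j by rewrite /f le_max lexx orbT.
have f_small j : (j <= k)%N -> f j = d j / d k.
  by move=> jk; apply/max_idPl; rewrite ler_pdivlMr // mul1r dd.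
have f_large j : (k < j)%N -> (j < m)%N -> f j = 1.
  by move=> kj jm; apply/max_idPr; rewrite ler_pdivrMr // mul1r dd // ltnW.
have fE : \prod_(v < m) f v = \prod_(i < k.+1) (d i / d k).
  rewrite (big_ord_widen m (fun i => d i / d k) km).
  rewrite (bigID (fun v : 'I_m => (v < k.+1)%N)) /=.
  rewrite [X in _ * X]big1 ?mulr1; last by move=> i; rewrite -leqNgt => ?; apply: f_large.
  by apply: eq_bigr => i; rewrite ltnS => /f_small.
have : \prod_(i < k.+1) (d (g i) / d k) <= \prod_(i < k.+1) (d i / d k).
  rewrite -fE; apply: (@le_trans _ _ (\prod_(i < k.+1) f (g i))).
    apply: ler_prod => i _; have di := dp _ (ltn_ord (g i)).
    by rewrite (divr_ge0 (ltW di) (ltW dk)) /f le_max lexx.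
  have -> : \prod_(i < k.+1) f (g i) = \prod_(v in [set g i | i in setT]) f (v : 'I_m).
    rewrite big_imset /=; last by move=> i j _ _ /gI.
    by apply: eq_bigl => i; rewrite in_setT.
  rewrite [leRHS](bigID (fun v => v \in [set g i | i in setT])) /=.
  rewrite ler_peMr //.
    by apply: prodr_ge0 => v _; rewrite (le_trans ler01).
  elim/big_rec: _ => // v x _ x1.
  by rewrite (le_trans x1) // ler_peMl // (le_trans ler01).
rewrite !prodf_div ler_pM2r // invr_gt0 prodr_gt0 //.
Qed.

(** A linear program: with total weight at most [k] and each weight at most one,
    the best choice puts weight one on the [k] largest terms. Termwise, the
    difference (1_(i < k) - p i) is multiplied by a number that is at least the
    k-th term where it is nonnegative, and at most the k-th term elsewhere. *)
Lemma sum_weight_le m k (d : nat -> R) (p : 'I_m -> R) :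
  (k <= m)%N -> decpos m d -> (forall i, 0 <= p i <= 1) ->
  \sum_i p i <= k%:R ->
  \sum_(i < m) d i * p i <= \sum_(i < k) d i.
Proof.
case: k => [|k] km [dp dd] p01 pk.
  rewrite big_ord0; have p0 : forall i, p i = 0.
    have /psumr_eq0P pz : \sum_i p i = 0.
      apply/eqP; rewrite eq_le pk sumr_ge0 // => i _; by case/andP: (p01 i).
    by move=> i; apply: pz => // j _; case/andP: (p01 j).
  by rewrite big1 // => i _; rewrite p0 mulr0.
rewrite (big_ord_widen m d km) [leRHS]big_mkcond /= -subr_ge0 -sumrB.
apply: (@le_trans _ _ (\sum_(i < m) d k * ((if (i < k.+1)%N then 1 else 0) - p i))).
  rewrite -mulr_sumr mulr_ge0 //; first exact/ltW/dp.
  rewrite sumrB -big_mkcond -(big_ord_widen m (fun=> 1) km) sumr_const card_ord.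
  by rewrite subr_ge0.
apply: ler_sum => i _; have /andP[p0 p1] := p01 i; rewrite ltnS.
case: leqP => ik; last by rewrite !sub0r mulrN lerN2 ler_wpM2r // dd // ltnW.
rewrite -[X in _ <= X - _]mulr1 -mulrBr ler_wpM2r ?subr_ge0 //; exact: dd.
Qed.

End TopWeights.

(** * Conjugate transposes, spectral forms and ordered eigenvalues *)

(** The conjugate transpose, opaque to unification and stated at the type of
    complex matrices, so that rewriting with associativity never has to compare
    the two algebraic structures that the entries inherit. *)
HB.lock Definition ctmx (R : realType) m n (A : 'M[R[i]]_(m, n)) : 'M[R[i]]_(n, m) :=
  A ^t*.
Canonical ctmx_unlockable := Unlockable ctmx.unlock.
Notation "A ^H" := (ctmx A) (at level 30).

Section Adjoint.
Variable R : realType.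
Local Notation C := R[i].

Lemma ctmxE m n (A : 'M[C]_(m, n)) : A ^t* = A^H.
Proof. by rewrite unlock. Qed.

Lemma ctE m n (A : 'M[C]_(m, n)) i j : (A^H) i j = Num.conj (A j i).
Proof. by rewrite -ctmxE !mxE. Qed.

Lemma ctK m n (A : 'M[C]_(m, n)) : A^H^H = A.
Proof. by rewrite -!ctmxE trmxCK. Qed.

Lemma ctM m n p (A : 'M[C]_(m, n)) (B : 'M[C]_(n, p)) :
  (A *m B)^H = B^H *m A^H.
Proof. by rewrite -!ctmxE trmx_mul map_mxM. Qed.

Lemma ctD m n (A B : 'M[C]_(m, n)) : (A + B)^H = A^H + B^H.
Proof. by rewrite -!ctmxE linearD /= map_mxD. Qed.

Lemma ctB m n (A B : 'M[C]_(m, n)) : (A - B)^H = A^H - B^H.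
Proof. by rewrite -!ctmxE linearB /= map_mxB. Qed.

Lemma ct1 n : (1%:M : 'M[C]_n)^H = 1%:M.
Proof. by rewrite -!ctmxE trmx1 map_mx1. Qed.

Lemma ct_unitmx n (A : 'M[C]_n) : (A^H \in unitmx) = (A \in unitmx).
Proof. by rewrite -!ctmxE map_unitmx unitmx_tr. Qed.

Lemma ct_col_mx m1 m2 n (A : 'M[C]_(m1, n)) (B : 'M[C]_(m2, n)) :
  (col_mx A B)^H = row_mx (A^H) (B^H).
Proof. by rewrite -!ctmxE tr_col_mx map_row_mx. Qed.

Lemma ct_row_mx m n1 n2 (A : 'M[C]_(m, n1)) (B : 'M[C]_(m, n2)) :
  (row_mx A B)^H = col_mx (A^H) (B^H).
Proof. by rewrite -!ctmxE tr_row_mx map_col_mx. Qed.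

Lemma det_ct n (A : 'M[C]_n) : \det (A^H) = Num.conj (\det A).
Proof. by rewrite -ctmxE det_map_mx det_tr. Qed.

Lemma conjC_real (a : R) : Num.conj (a%:C : C) = a%:C.
Proof. by apply/CrealP; rewrite complex_real. Qed.

Definition rdiag n (d : nat -> R) : 'M[C]_n := diag_mx (\row_(i < n) (d i)%:C).

Lemma ct_rdiag n d : (rdiag n d)^H = rdiag n d.
Proof.
rewrite -ctmxE /rdiag tr_diag_mx map_diag_mx; congr diag_mx.
by apply/rowP => i; rewrite !mxE; apply: conjC_real.
Qed.

Lemma rdiagM n c d : rdiag n c *m rdiag n d = rdiag n (fun j => c j * d j).
Proof.
rewrite /rdiag mulmx_diag; congr diag_mx.
by apply/rowP => i; rewrite !mxE rmorphM.
Qed.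

Lemma det_rdiag n d : \det (rdiag n d) = (\prod_(j < n) d j)%:C.
Proof. by rewrite det_diag rmorph_prod; apply: eq_bigr => i _; rewrite mxE. Qed.

Lemma tr_rdiag n d : \tr (rdiag n d) = (\sum_(j < n) d j)%:C.
Proof. by rewrite mxtrace_diag rmorph_sum; apply: eq_bigr => i _; rewrite mxE. Qed.

Lemma eq_rdiag n c d : (forall j, (j < n)%N -> c j = d j) -> rdiag n c = rdiag n d.
Proof. by move=> cd; congr diag_mx; apply/rowP => i; rewrite !mxE cd. Qed.

Lemma rdiag1 n d : (forall j, (j < n)%N -> d j = 1) -> rdiag n d = 1%:M.
Proof.
move=> d1; rewrite -diag_const_mx; congr diag_mx.
by apply/rowP => i; rewrite !mxE d1.
Qed.

Lemma rdiag_quad n d (x : 'cV[C]_n) :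
  (x^H *m rdiag n d *m x) 0 0 = \sum_(i < n) (d i)%:C * `|x i 0| ^+ 2.
Proof.
rewrite -mulmxA mul_diag_mx !mxE; apply: eq_bigr => i _.
by rewrite !mxE ctE normCKC mulrCA.
Qed.

Lemma gram_diag m n (Z : 'M[C]_(m, n)) i :
  (Z *m Z^H) i i = \sum_j `|Z i j| ^+ 2.
Proof. by rewrite mxE; apply: eq_bigr => j _; rewrite ctE normCK. Qed.

Lemma unitaryP n (U : 'M[C]_n) : U \is unitarymx ->
  (U *m U^H = 1%:M) * (U^H *m U = 1%:M).
Proof.
move=> Uu; have UV : U *m U^H = 1%:M by rewrite -ctmxE; apply/unitarymxP.
by split=> //; apply: mulmx1C.
Qed.

Lemma unitary_intro n (U : 'M[C]_n) : U^H *m U = 1%:M -> U \is unitarymx.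
Proof. by rewrite -ctmxE => /mulmx1C ?; apply/unitarymxP. Qed.

Lemma unitaryVK m n (A : 'M[C]_(m, n)) (U : 'M[C]_n) : U \is unitarymx ->
  A *m U *m U^H = A.
Proof. by move=> Uu; rewrite -mulmxA (unitaryP Uu).1 mulmx1. Qed.

Lemma unitaryKV m n (A : 'M[C]_(m, n)) (U : 'M[C]_n) : U \is unitarymx ->
  A *m U^H *m U = A.
Proof. by move=> Uu; rewrite -mulmxA (unitaryP Uu).2 mulmx1. Qed.

Lemma hermP n (A : 'M[C]_n) : reflect (A^H = A) (A \is hermsymmx).
Proof.
by rewrite -ctmxE; apply: (iffP (is_hermitianmxP _ _ _)); rewrite expr0 scale1r.
Qed.

Lemma posdef_ct n (A : 'M[C]_n) : posdefmx A -> A^H = A.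
Proof. by case=> /hermP. Qed.

Lemma posdefD n (A B : 'M[C]_n) : posdefmx A -> posdefmx B -> posdefmx (A + B).
Proof.
move=> [/hermP hA pA] [/hermP hB pB]; split; first by apply/hermP; rewrite ctD hA hB.
by move=> x x0; rewrite mulmxDr mulmxDl mxE addr_gt0 ?pA ?pB.
Qed.

(** Injectivity of [J] is written as a trivial kernel, since [J] may have more
    rows than columns. *)
Lemma posdef_congr m n (A : 'M[C]_m) (J : 'M[C]_(m, n)) :
  posdefmx A -> (forall x : 'cV_n, J *m x = 0 -> x = 0) ->
  posdefmx (J^H *m A *m J).
Proof.
move=> [/hermP hA pA] Jinj; split; first by apply/hermP; rewrite !ctM ctK hA mulmxA.
move=> x x0; rewrite ctmxE; have -> : x^H *m (J^H *m A *m J) *m x = (J *m x)^H *m A *m (J *m x).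
  by rewrite ctM !mulmxA.
by rewrite -ctmxE; apply: pA; apply: contra_neq x0; apply: Jinj.
Qed.

Lemma unit_inj n p (J : 'M[C]_n) : J \in unitmx ->
  forall x : 'M_(n, p), J *m x = 0 -> x = 0.
Proof. by move=> Ju x Jx; rewrite -[x](mulKmx Ju) Jx mulmx0. Qed.

Lemma posdef_congr_unit n (A J : 'M[C]_n) :
  posdefmx A -> J \in unitmx -> posdefmx (J^H *m A *m J).
Proof. by move=> pA Ju; apply: posdef_congr => // x; apply: unit_inj. Qed.

Lemma posdef_rdiag n d : (forall j, (j < n)%N -> 0 < d j) -> posdefmx (rdiag n d).
Proof.
move=> dp; split; first exact/hermP/ct_rdiag.
move=> x x0; rewrite ctmxE rdiag_quad; have /cV0Pn [i xi] := x0.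
rewrite (bigD1 i) //= ltr_wpDr ?sumr_ge0 // => [j _|].
  by rewrite mulr_ge0 ?exprn_ge0 // lecR ltW ?dp.
by rewrite mulr_gt0 ?exprn_gt0 ?normr_gt0 // ltcR dp.
Qed.

Lemma posdef1 n : posdefmx (1%:M : 'M[C]_n).
Proof. by rewrite -(@rdiag1 n (fun=> 1)) //; apply: posdef_rdiag. Qed.

Lemma posdef_gram m n (J : 'M[C]_(m, n)) :
  (forall x : 'cV_n, J *m x = 0 -> x = 0) -> posdefmx (J^H *m J).
Proof.
by move=> Jinj; have := posdef_congr (posdef1 m) Jinj; rewrite mulmx1.
Qed.

Definition spectral_form n (U : 'M[C]_n) (d : nat -> R) (A : 'M[C]_n) :=
  U \is unitarymx /\ A = U^H *m rdiag n d *m U.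

Lemma spectral_form_ct n U d (A : 'M[C]_n) : spectral_form U d A -> A^H = A.
Proof. by case=> _ ->; rewrite !ctM ctK ct_rdiag mulmxA. Qed.

Lemma spectral_form_posdef n U d (A : 'M[C]_n) : spectral_form U d A ->
  (forall j, (j < n)%N -> 0 < d j) -> posdefmx A.
Proof.
case=> Uu -> dp; apply: posdef_congr_unit; first exact: posdef_rdiag.
exact: unitarymx_unit.
Qed.

(** Eigenvalues in decreasing order with multiplicity, extended by zero beyond
    the size of the matrix. *)
Definition eigs n (A : 'M[C]_n) : nat -> R :=
  nth 0 (sort (fun x y : R => y <= x)
    [seq complex.Re (spectral_diag A 0 i) | i <- enum 'I_n]).

Lemma spectral_decomp n (A : 'M[C]_n) : A^H = A ->
  A = (spectralmx A)^H *m diag_mx (spectral_diag A) *m spectralmx A.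
Proof.
move=> hA; rewrite -ctmxE -invmx_unitary ?spectral_unitarymx //.
by apply/orthomx_spectralP/hermitian_normalmx/hermP.
Qed.

Lemma spectral_diag_Re n (A : 'M[C]_n) i : A^H = A ->
  spectral_diag A 0 i = (complex.Re (spectral_diag A 0 i))%:C.
Proof.
move=> /hermP /hermitian_spectral_diag_real /mxOverP /(_ 0 i).
by move/RRe_real => ->.
Qed.

(** Sorting the diagonal of a spectral decomposition permutes the rows of the
    unitary matrix. Positivity of the i-th eigenvalue is positivity of the
    quadratic form at the i-th eigenvector. *)
Lemma posdef_spectral_form n (A : 'M[C]_n) : posdefmx A ->
  (exists U, spectral_form U (eigs A) A) /\ decpos n (eigs A).
Proof.
move=> pA; have hA := posdef_ct pA.
set s := [seq complex.Re (spectral_diag A 0 i) | i <- enum 'I_n].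
have sn : size s = n by rewrite size_map size_enum_ord.
have sort_n : size (sort (fun x y : R => y <= x) s) == n by rewrite size_sort sn.
have s_n : size s == n by rewrite sn.
have : perm_eq (Tuple sort_n) (Tuple s_n) by rewrite /= perm_sort.
case/tuple_permP => p /= pE.
have eE (i : 'I_n) : (eigs A i)%:C = spectral_diag A 0 (p i).
  rewrite spectral_diag_Re // /eigs -/s pE (nth_map i) ?size_enum_ord //.
  rewrite nth_ord_enum (tnth_nth 0) /= (nth_map i) ?size_enum_ord //.
  by rewrite nth_ord_enum.
pose U0 := spectralmx A; have [U0V U0K] := unitaryP (spectral_unitarymx A).
pose U : 'M[C]_n := \matrix_(i, j) U0 (p i) j.
have UU : U \is unitarymx.
  apply: unitary_intro; apply: mulmx1C; apply/matrixP => i j.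
  move/matrixP: U0V => /(_ (p i) (p j)).
  rewrite !mxE (inj_eq perm_inj) => <-; apply: eq_bigr => k _.
  by rewrite !ctE !mxE.
have AU : A = U^H *m rdiag n (eigs A) *m U.
  rewrite {1}(spectral_decomp hA) -/U0; apply/matrixP => i j.
  rewrite -!mulmxA !mul_diag_mx !mxE (reindex_inj (@perm_inj _ p)) /=.
  by apply: eq_bigr => k _; rewrite !ctE !mxE eE.
split; first by exists U.
split=> [i ik|i j ij jk]; last first.
  rewrite /eigs -/s; apply: (@sorted_leq_nth _ (fun x y : R => y <= x) _ _ 0) => //.
  - by move=> y x z xy yz; apply: le_trans yz xy.
  - by apply: sort_sorted => x y; apply: le_total.
  - by rewrite inE size_sort sn (leq_ltn_trans ij).
  - by rewrite inE size_sort sn.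
have [_ pos] := pA.
pose x : 'cV[C]_n := U^H *m delta_mx (Ordinal ik) 0.
have x0 : x != 0.
  apply/negP => /eqP xz.
  have : U *m x = 0 by rewrite xz mulmx0.
  rewrite /x mulmxA (unitaryP UU).1 mul1mx => /matrixP /(_ (Ordinal ik) 0).
  by rewrite !mxE !eqxx => /eqP; rewrite oner_eq0.
have := pos x x0; rewrite ctmxE.
have -> : x^H *m A *m x = (delta_mx (Ordinal ik) 0)^H *m rdiag n (eigs A) *m delta_mx (Ordinal ik) 0.
  rewrite {1}AU /x ctM ctK !mulmxA -[_ *m U *m U^H]mulmxA (unitaryP UU).1 mulmx1.
  by rewrite -!mulmxA (mulmxA U (U^H)) (unitaryP UU).1 mul1mx.
rewrite rdiag_quad (bigD1 (Ordinal ik)) //= big1 ?addr0; last first.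
  by move=> j /negPf ji; rewrite mxE ji normr0 expr0n mulr0.
by rewrite mxE !eqxx normr1 expr1n mulr1 ltcR.
Qed.

End Adjoint.

(** * Real powers of positive definite matrices *)

(** A copy of the functional calculus power that does not unfold to a matrix
    product when products are matched. *)
HB.lock Definition mxpow (R : realType) n (A : 'M[R[i]]_n) (s : R) : 'M[R[i]]_n :=
  powmx A s.
Canonical mxpow_unlockable := Unlockable mxpow.unlock.

Section Powers.
Variable R : realType.
Local Notation C := R[i].

(** The functional calculus does not depend on the diagonalization: if [W]
    intertwines two diagonal matrices, a nonzero entry of [W] forces the two
    corresponding diagonal entries to agree, so [W] also intertwines their
    images under [f]. *)
Lemma funmx_spectral_form n U d (A : 'M[C]_n) f : spectral_form U d A ->
  spectral_form U (fun j => f (d j)) (funmx f A).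
Proof.
move=> Ad; have hA := spectral_form_ct Ad; case: Ad => Uu AU; split; first exact: Uu.
have [UV UK] := unitaryP Uu.
set P := spectralmx A; have [PV PK] := unitaryP (spectral_unitarymx A).
rewrite -/P in PV PK; set s := spectral_diag A.
have AP : A = P^H *m diag_mx s *m P by apply: spectral_decomp.
pose W := U *m P^H.
have WE : W *m diag_mx s = rdiag n d *m W.
  have <- : U *m A *m P^H = W *m diag_mx s.
    by rewrite {1}AP /W -!mulmxA PV mulmx1.
  by rewrite AU /W !mulmxA UV mul1mx.
have Wf : W *m diag_mx (map_mx (fun z : C => (f (complex.Re z))%:C) s)
          = rdiag n (fun j => f (d j)) *m W.
  clearbody W; apply/matrixP => i j; move/matrixP: WE => /(_ i j).
  rewrite mul_mx_diag mul_diag_mx mul_mx_diag mul_diag_mx !mxE.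
  have [->|W0] := eqVneq (W i j) 0; first by rewrite !mulr0 !mul0r.
  by rewrite mulrC => /(mulIf W0) ->; rewrite mulrC.
rewrite /funmx ctmxE -/P -/s.
have -> : P^H = U^H *m W by rewrite /W mulmxA UK mul1mx.
rewrite -[_ *m W *m _]mulmxA Wf /W.
by rewrite -!mulmxA PK mulmx1.
Qed.

Lemma spectral_form_inj n U c d (A B : 'M[C]_n) : spectral_form U c A -> spectral_form U d B ->
  (forall j, (j < n)%N -> c j = d j) -> A = B.
Proof. by move=> [_ ->] [_ ->] cd; rewrite (eq_rdiag cd). Qed.

Lemma spectral_formM n U c d (A B : 'M[C]_n) : spectral_form U c A -> spectral_form U d B ->
  spectral_form U (fun j => c j * d j) (A *m B).
Proof.
move=> [Uu ->] [_ ->]; split; first exact: Uu.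
by rewrite -rdiagM !mulmxA unitaryVK.
Qed.

Lemma mxpowE n (A : 'M[C]_n) s : powmx A s = mxpow A s.
Proof. by rewrite unlock. Qed.

Lemma mxpow_spectral_form n U d (A : 'M[C]_n) s : spectral_form U d A ->
  spectral_form U (fun j => powR (d j) s) (mxpow A s).
Proof. rewrite -mxpowE; exact: funmx_spectral_form. Qed.

Section PosDef.
Variables (n : nat) (A : 'M[C]_n).
Hypothesis pA : posdefmx A.

Lemma posdef_mxpow s : posdefmx (mxpow A s).
Proof.
have [[U AU] [dp _]] := posdef_spectral_form pA.
by apply: (spectral_form_posdef (mxpow_spectral_form s AU)) => j jn; rewrite powR_gt0 ?dp.
Qed.

Lemma mxpowD s t : mxpow A s *m mxpow A t = mxpow A (s + t).
Proof.
have [[U AU] [dp _]] := posdef_spectral_form pA.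
have AsAt := spectral_formM (mxpow_spectral_form s AU) (mxpow_spectral_form t AU).
apply: (spectral_form_inj AsAt (mxpow_spectral_form _ AU)).
by move=> j jn; rewrite powRD // (gt_eqF (dp j jn)) implybT.
Qed.

Lemma mxpowM s t : mxpow (mxpow A s) t = mxpow A (s * t).
Proof.
have [[U AU] [dp _]] := posdef_spectral_form pA.
apply: (spectral_form_inj (mxpow_spectral_form t (mxpow_spectral_form s AU)) (mxpow_spectral_form _ AU)).
by move=> j jn; rewrite powRrM.
Qed.

Lemma mxpow1 : mxpow A 1 = A.
Proof.
have [[U AU] [dp _]] := posdef_spectral_form pA.
apply: (spectral_form_inj (mxpow_spectral_form 1 AU) AU).
by move=> j jn; rewrite powRr1 // ltW ?dp.
Qed.

Lemma mxpow0 : mxpow A 0 = 1%:M.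
Proof.
have [[U AU] [dp _]] := posdef_spectral_form pA.
have [Uu ->] := mxpow_spectral_form 0 AU.
rewrite rdiag1 => [|j jn]; last by rewrite powRr0.
by rewrite mulmx1 (unitaryP Uu).2.
Qed.

Lemma mxpowNK s : mxpow A s *m mxpow A (- s) = 1%:M.
Proof. by rewrite mxpowD subrr mxpow0. Qed.

Lemma mxpowKN s : mxpow A (- s) *m mxpow A s = 1%:M.
Proof. by rewrite mxpowD addNr mxpow0. Qed.

Lemma mxpow_unit s : mxpow A s \in unitmx.
Proof. have [h _] := mulmx1_unit (mxpowNK s); exact: h. Qed.

Lemma posdef_unit : A \in unitmx.
Proof. by rewrite -mxpow1 mxpow_unit. Qed.

Lemma ct_mxpow s : (mxpow A s)^H = mxpow A s.
Proof. exact/posdef_ct/posdef_mxpow. Qed.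

Lemma posdef_det : 0 < \det A.
Proof.
have [[U [Uu AU]] [dp _]] := posdef_spectral_form pA.
rewrite AU !det_mulmx mulrAC -det_mulmx (unitaryP Uu).2 det1 mul1r det_rdiag ltcR.
by apply: prodr_gt0 => i _; apply: dp.
Qed.

Lemma mxpow_half : mxpow A (1 / 2) *m mxpow A (1 / 2) = A.
Proof. by rewrite mxpowD -splitr mxpow1. Qed.

Lemma posdef_sqr : posdefmx (A *m A).
Proof. by rewrite -{1 2}mxpow1 mxpowD; apply: posdef_mxpow. Qed.

End PosDef.

Definition bdiag n (A B : 'M[C]_n) : 'M[C]_(n + n) := block_mx A 0 0 B.

Lemma bdiagM n (A B A' B' : 'M[C]_n) :
  bdiag A B *m bdiag A' B' = bdiag (A *m A') (B *m B').
Proof. by rewrite /bdiag mulmx_block !mulmx0 !mul0mx !addr0 !add0r. Qed.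

Lemma ct_bdiag n (A B : 'M[C]_n) : (bdiag A B)^H = bdiag (A^H) (B^H).
Proof. by rewrite -!ctmxE /bdiag tr_block_mx map_block_mx !trmx0 !map_mx0. Qed.

Lemma bdiag1 n : bdiag 1%:M 1%:M = 1%:M :> 'M[C]_(n + n).
Proof. by rewrite /bdiag -scalar_mx_block. Qed.

Lemma bdiag_spectral_form n U d V e (A B : 'M[C]_n) : spectral_form U d A -> spectral_form V e B ->
  spectral_form (bdiag U V) (fun j => if (j < n)%N then d j else e (j - n)%N) (bdiag A B).
Proof.
move=> [Uu ->] [Vu ->]; split.
  apply: unitary_intro; rewrite ct_bdiag bdiagM.
  by rewrite (unitaryP Uu).2 (unitaryP Vu).2 bdiag1.
have -> : rdiag (n + n) (fun j => if (j < n)%N then d j else e (j - n)%N)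
          = bdiag (rdiag n d) (rdiag n e).
  rewrite /bdiag /rdiag -diag_mx_row; congr diag_mx.
  apply/rowP => i; rewrite !mxE; case: splitP => j ij; rewrite mxE ij ?ltn_ord //.
  by rewrite addKn.
by rewrite ct_bdiag !bdiagM.
Qed.

Lemma bdiag_posdef n (A B : 'M[C]_n) : posdefmx A -> posdefmx B ->
  posdefmx (bdiag A B).
Proof.
move=> /posdef_spectral_form [[U AU] [dp _]] /posdef_spectral_form [[V BV] [ep _]].
apply: (spectral_form_posdef (bdiag_spectral_form AU BV)) => j jn.
case: ltnP => [/dp //|nj]; apply: ep; lia.
Qed.

Lemma mxpow_bdiag n (A B : 'M[C]_n) s : posdefmx A -> posdefmx B ->
  mxpow (bdiag A B) s = bdiag (mxpow A s) (mxpow B s).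
Proof.
move=> /posdef_spectral_form [[U AU] _] /posdef_spectral_form [[V BV] _].
apply: (spectral_form_inj (mxpow_spectral_form s (bdiag_spectral_form AU BV))
  (bdiag_spectral_form (mxpow_spectral_form s AU) (mxpow_spectral_form s BV))).
by move=> j jn; case: ifP.
Qed.

End Powers.

(** * Extremal inequalities for sums and products of eigenvalues *)

Section KyFan.
Variable R : realType.
Local Notation C := R[i].

(** The largest eigenvalue of the k-th exterior power of [A]. Inequalities
    between these products for all [k] are the log-majorizations of the proof. *)
Definition eigprod n k (A : 'M[C]_n) : R := \prod_(j < k) eigs A j.

(** By Cauchy-Binet both sides are sums of squared moduli of the minors of [V],
    with weights given by products of [k] distinct diagonal entries on the left,
    and by the largest such product on the right. *)
Lemma det_rdiag_le m k d (V : 'M[C]_(m, k)) : decpos m d ->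
  \det (V^H *m rdiag m d *m V) <= (\prod_(j < k) d j)%:C * \det (V^H *m V).
Proof.
move=> dd; have fk : 0 < k`!%:R :> C by rewrite ltr0n fact_gt0.
rewrite -mulmxA -(ler_pM2l fk) [leRHS]mulrCA -!Cauchy_Binet mulr_sumr.
apply: ler_sum => g _.
have -> : colsub g (V^H) = (rowsub g V)^H.
  by apply/matrixP => i j; rewrite !(ctE, mxE).
have -> : rowsub g (rdiag m d *m V) = diag_mx (\row_i (d (g i))%:C) *m rowsub g V.
  by apply/matrixP => i j; rewrite /rdiag !mul_diag_mx !mxE.
rewrite det_mulmx det_diag det_ct mulrCA -normCKC.
have [/injectiveP gI|/injectivePn [i [j ij gij]]] := boolP (injectiveb g); last first.
  rewrite (determinant_alternate ij) ?normr0 ?expr0n ?mulr0 //.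
  by move=> l; rewrite !mxE gij.
rewrite ler_wpM2r ?exprn_ge0 //.
under eq_bigr => i _ do rewrite mxE.
by rewrite -rmorph_prod lecR; apply: prod_inj_le.
Qed.

Lemma det_spec_le m k U d (A : 'M[C]_m) (V : 'M[C]_(m, k)) :
  spectral_form U d A -> decpos m d ->
  \det (V^H *m A *m V) <= (\prod_(j < k) d j)%:C * \det (V^H *m V).
Proof.
move=> [Uu ->] dd; have := det_rdiag_le (U *m V) dd.
by rewrite !ctM !mulmxA unitaryKV.
Qed.

(** This single inequality, with equality when the columns of [V] are the top
    eigenvectors, stands in for the functoriality of exterior powers. The matrix
    [V] need not be an isometry, which is what makes the next lemmas short. *)
Lemma det_compression_le m k (A : 'M[C]_m) (V : 'M[C]_(m, k)) : posdefmx A ->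
  \det (V^H *m A *m V) <= (eigprod k A)%:C * \det (V^H *m V).
Proof. by case/posdef_spectral_form=> [[U AU] dd]; apply: det_spec_le AU dd. Qed.

Lemma top_spec_vectors m k U d (A : 'M[C]_m) : (k <= m)%N -> spectral_form U d A ->
  exists2 V : 'M[C]_(m, k), V^H *m V = 1%:M & A *m V = V *m rdiag k d.
Proof.
move=> km [Uu ->]; pose w := widen_ord km.
pose E : 'M[C]_(m, k) := colsub w 1%:M.
have [UV UK] := unitaryP Uu.
have EE : E^H *m E = 1%:M.
  have -> : E^H = rowsub w 1%:M.
    by apply/matrixP => i j; rewrite !(ctE, mxE) rmorph_nat eq_sym.
  by rewrite mul_rowsub_mx mul1mx; apply/matrixP => i j; rewrite !mxE.
exists (U^H *m E).
  by rewrite ctM ctK !mulmxA unitaryVK.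
rewrite mulmxA unitaryVK // -!mulmxA; congr (_ *m _).
apply/matrixP => i j; rewrite mul_diag_mx mul_mx_diag !mxE.
by case: eqP => [->|_]; rewrite ?mulr1 ?mul1r ?mulr0 ?mul0r.
Qed.

Lemma top_vectors m k (A : 'M[C]_m) : (k <= m)%N -> posdefmx A ->
  exists2 V : 'M[C]_(m, k), V^H *m V = 1%:M & A *m V = V *m rdiag k (eigs A).
Proof. by move=> km /posdef_spectral_form [[U AU] _]; apply: top_spec_vectors AU. Qed.

Lemma top_compression m k d (A : 'M[C]_m) (V : 'M[C]_(m, k)) :
  V^H *m V = 1%:M -> A *m V = V *m rdiag k d -> V^H *m A *m V = rdiag k d.
Proof. by move=> VV AV; rewrite -mulmxA AV mulmxA VV mul1mx. Qed.

Lemma eigprod_gt0 n k (A : 'M[C]_n) : posdefmx A -> (k <= n)%N -> 0 < eigprod k A.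
Proof.
case/posdef_spectral_form=> _ [dp _] kn; apply: prodr_gt0 => i _.
exact/dp/(leq_trans (ltn_ord i)).
Qed.

Lemma eigs_ge0 n (A : 'M[C]_n) j : posdefmx A -> 0 <= eigs A j.
Proof.
case/posdef_spectral_form=> _ [dp _]; case: (ltnP j n) => [/dp/ltW //|nj].
by rewrite /eigs nth_default // size_sort size_map size_enum_ord.
Qed.

Lemma eigprod_ge0 n k (A : 'M[C]_n) : posdefmx A -> 0 <= eigprod k A.
Proof. by move=> pA; apply: prodr_ge0 => i _; apply: eigs_ge0. Qed.

(** Products of leading eigenvalues are maxima of determinants of compressions
    to isometries, so they do not depend on the spectral form in use. *)
Lemma eigprod_spec n k U d (A : 'M[C]_n) : spectral_form U d A -> decpos n d -> (k <= n)%N ->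
  eigprod k A = \prod_(j < k) d j.
Proof.
move=> Ad dd kn; have pA := spectral_form_posdef Ad dd.1.
apply/eqP; rewrite eq_le; apply/andP; split; rewrite -lecR.
  have [V VV AV] := top_vectors kn pA.
  by have := det_spec_le V Ad dd; rewrite (top_compression VV AV) VV det1 det_rdiag mulr1.
have [V VV AV] := top_spec_vectors kn Ad.
by have := det_compression_le V pA; rewrite (top_compression VV AV) VV det1 det_rdiag mulr1.
Qed.

Lemma eigs_spec n U d (A : 'M[C]_n) : spectral_form U d A -> decpos n d ->
  forall j, (j < n)%N -> eigs A j = d j.
Proof.
move=> Ad dd j jn; have pA := spectral_form_posdef Ad dd.1.
have := eigprod_spec Ad dd jn; rewrite /eigprod !big_ord_recr /=.
have := eigprod_spec Ad dd (ltnW jn); rewrite /eigprod => ->; apply: mulfI.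
by rewrite gt_eqF // prodr_gt0 // => i _; apply/dd.1/(ltn_trans (ltn_ord i)).
Qed.

Lemma eigs_mxpow n (A : 'M[C]_n) s j : posdefmx A -> 0 <= s -> (j < n)%N ->
  eigs (mxpow A s) j = powR (eigs A j) s.
Proof.
move=> pA s0; have [[U AU] dd] := posdef_spectral_form pA.
by move: j; apply: eigs_spec (mxpow_spectral_form s AU) (decpos_powR s0 dd).
Qed.

Lemma eigprod_mxpow n k (A : 'M[C]_n) s : posdefmx A -> 0 <= s -> (k <= n)%N ->
  eigprod k (mxpow A s) = powR (eigprod k A) s.
Proof.
move=> pA s0 kn; have [_ [dp _]] := posdef_spectral_form pA.
rewrite /eigprod prod_powR; last by move=> j jk; apply/dp/(leq_trans jk).
by apply: eq_bigr => j _; rewrite eigs_mxpow // (leq_trans (ltn_ord j)).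
Qed.

(** Compress to the top eigenvectors [V] of J^H K J, and use the determinant
    inequality twice: for [K] with the vectors J V, then for J^H J with [V]. *)
Lemma eigprod_Horn m n k (K : 'M[C]_m) (J : 'M[C]_(m, n)) :
  posdefmx K -> (forall x : 'cV_n, J *m x = 0 -> x = 0) -> (k <= n)%N ->
  eigprod k (J^H *m K *m J) <= eigprod k K * eigprod k (J^H *m J).
Proof.
move=> pK Jinj kn.
have pJ := posdef_gram Jinj.
have [V VV AV] := top_vectors kn (posdef_congr pK Jinj).
rewrite -lecR; have := det_compression_le (J *m V) pK.
have -> : (J *m V)^H *m K *m (J *m V) = V^H *m (J^H *m K *m J) *m V.
  by rewrite ctM !mulmxA.
rewrite (top_compression VV AV) det_rdiag => /le_trans; apply.
have -> : (J *m V)^H *m (J *m V) = V^H *m (J^H *m J) *m V.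
  by rewrite ctM !mulmxA.
rewrite rmorphM ler_wpM2l ?lecR ?eigprod_ge0 //.
by have := det_compression_le V pJ; rewrite VV det1 mulr1.
Qed.

(** [T] is similar to [K]. The top eigenvectors of [K] are carried by the inverse
    of [Z] to eigenvectors W of [T] with the same eigenvalues, and the
    determinant inequality for T^H T at [W] compares the squared product of those
    eigenvalues with the leading singular values of [T]. *)
Lemma eigprod_Weyl n k (K Z T : 'M[C]_n) : posdefmx K -> Z \in unitmx ->
  Z *m T = K *m Z -> (k <= n)%N ->
  eigprod k K ^+ 2 <= eigprod k (T^H *m T).
Proof.
move=> pK Zu ZT kn; have [V VV KV] := top_vectors kn pK.
have Tu : T \in unitmx.
  have : Z *m T \in unitmx by rewrite ZT unitmx_mul posdef_unit.
  by rewrite unitmx_mul Zu.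
pose W := invmx Z *m V.
have ZW : Z *m W = V by rewrite mulKVmx.
have TW : T *m W = W *m rdiag k (eigs K).
  by rewrite -[LHS](mulKmx Zu) (mulmxA Z) ZT -(mulmxA K) ZW KV mulmxA.
have pT : posdefmx (T^H *m T) by apply: posdef_gram; apply: unit_inj.
have pW : posdefmx (W^H *m W).
  apply: posdef_gram => x Wx.
  by rewrite -[x]mul1mx -VV -mulmxA -ZW -mulmxA Wx !mulmx0.
have dW := posdef_det pW.
have := det_compression_le W pT.
have -> : W^H *m (T^H *m T) *m W = rdiag k (eigs K) *m (W^H *m W) *m rdiag k (eigs K).
  have -> : W^H *m (T^H *m T) *m W = (T *m W)^H *m (T *m W).
    by rewrite ctM !mulmxA.
  by rewrite TW ctM ct_rdiag !mulmxA.
rewrite !det_mulmx mulrAC -!det_mulmx det_mulmx ler_pM2r //.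
by rewrite det_mulmx det_rdiag -rmorphM lecR expr2.
Qed.

Lemma gram_ge0 m n (Z : 'M[C]_(m, n)) i : 0 <= (Z *m Z^H) i i.
Proof. by rewrite gram_diag sumr_ge0 // => j _; rewrite exprn_ge0. Qed.

Lemma gram_tr_ge0 m n (Z : 'M[C]_(m, n)) : 0 <= \tr (Z *m Z^H).
Proof. by rewrite sumr_ge0 // => i _; rewrite gram_ge0. Qed.

(** 1 - V V^H is an orthogonal projection, hence its own Gram square; this turns
    the Bessel inequality into positivity of a Gram matrix. *)
Lemma isometry_compl m n (V : 'M[C]_(m, n)) : V^H *m V = 1%:M ->
  exists Q : 'M[C]_m, Q *m Q^H = 1%:M - V *m V^H.
Proof.
move=> VV; exists (1%:M - V *m V^H).
rewrite ctB ct1 ctM ctK mulmxBl mul1mx mulmxBr mulmx1.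
by rewrite !mulmxA -[V *m V^H *m V]mulmxA VV mulmx1 subrr subr0.
Qed.

(** J J^H has the same nonzero eigenvalues as J^H J, with an isometry [O] of
    eigenvectors. In that basis the trace is a combination of the eigenvalues
    whose weights are the diagonal entries of O^H V V^H O: each is at most one
    and their sum is at most [k], by the Bessel inequality for [V] and for [O]. *)
Lemma sum_eigs_gram m n k (J : 'M[C]_(m, n)) (V : 'M[C]_(m, k)) :
  (forall x : 'cV_n, J *m x = 0 -> x = 0) -> (k <= n)%N ->
  V^H *m V = 1%:M ->
  \tr (V^H *m (J *m J^H) *m V) <= (\sum_(j < k) eigs (J^H *m J) j)%:C.
Proof.
move=> Jinj kn VV; have pS := posdef_gram Jinj.
have [[U [Uu SU]] dd] := posdef_spectral_form pS; have [UV UK] := unitaryP Uu.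
set w := eigs _ in SU dd *.
pose c j := powR (w j) (- (1 / 2)).
have cwc j : (j < n)%N -> c j * w j * c j = 1.
  move=> jn; have wj := dd.1 j jn; rewrite mulrAC /c -powRD ?(gt_eqF wj) ?implybT //.
  by rewrite -opprD -splitr powRN powRr1 ?ltW // mulVf // gt_eqF.
(* The polar isometry of [J], in the eigenbasis of its Gram matrix. *)
pose O := J *m U^H *m rdiag n c.
have OO : O^H *m O = 1%:M.
  rewrite /O !ctM ctK ct_rdiag.
  have -> : rdiag n c *m (U *m J^H) *m (J *m U^H *m rdiag n c)
    = rdiag n c *m U *m (J^H *m J) *m U^H *m rdiag n c by rewrite !mulmxA.
  rewrite SU !mulmxA unitaryVK // unitaryVK // !rdiagM; apply: rdiag1 => j jn.
  exact: cwc.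
have JO : J *m J^H = O *m rdiag n w *m O^H.
  rewrite /O !ctM ctK ct_rdiag.
  have -> : J *m U^H *m rdiag n c *m rdiag n w *m (rdiag n c *m (U *m J^H))
    = J *m U^H *m (rdiag n c *m rdiag n w *m rdiag n c) *m (U *m J^H) by rewrite !mulmxA.
  rewrite !rdiagM (rdiag1 cwc) mulmx1 !mulmxA unitaryKV //.
clearbody O; pose Y := O^H *m V.
have YE i : (Y *m Y^H) i i = (complex.Re ((Y *m Y^H) i i))%:C.
  by rewrite RRe_real // ger0_real // gram_ge0.
have -> : V^H *m (J *m J^H) *m V = Y^H *m (rdiag n w *m Y).
  by rewrite JO /Y ctM ctK !mulmxA.
rewrite mxtrace_mulC -mulmxA.
have -> : \tr (rdiag n w *m (Y *m Y^H))
  = (\sum_(i < n) w i * complex.Re ((Y *m Y^H) i i))%:C.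
  rewrite rmorph_sum; apply: eq_bigr => i _; rewrite rmorphM /= -YE.
  by rewrite mul_diag_mx mxE [X in X * _]mxE.
rewrite lecR; apply: (@sum_weight_le _ n k w) => //.
  move=> i; rewrite -!lecR -YE gram_ge0 /=.
  have [Q QQ] := isometry_compl VV.
  have := gram_ge0 (O^H *m Q) i.
  rewrite ctM ctK mulmxA -[O^H *m Q *m _]mulmxA QQ mulmxBr mulmx1 mulmxBl OO.
  have -> : O^H *m (V *m V^H) *m O = Y *m Y^H.
    by rewrite /Y ctM ctK !mulmxA.
  by rewrite !mxE eqxx subr_ge0.
rewrite -lecR rmorph_sum /=; under eq_bigr => i _ do rewrite -YE.
have [Q QQ] := isometry_compl OO.
have := gram_tr_ge0 (V^H *m Q).
rewrite ctM ctK mulmxA -[V^H *m Q *m _]mulmxA QQ mulmxBr mulmx1 mulmxBl VV.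
have -> : V^H *m (O *m O^H) *m V = Y^H *m Y by rewrite /Y ctM ctK !mulmxA.
by rewrite linearB /= mxtrace1 mxtrace_mulC subr_ge0 rmorph_nat.
Qed.

End KyFan.

(** * The Araki inequality *)

Section Majorizations.
Variable R : realType.
Local Notation C := R[i].

Lemma ln_geometric_mid (x y z : R) : 0 < x -> 0 < y -> 0 < z -> z ^+ 2 <= x * y ->
  ln z <= (ln x + ln y) / 2.
Proof.
move=> x0 y0 z0 zxy; have : ln (z ^+ 2) <= ln (x * y).
  by rewrite ler_ln ?posrE ?exprn_gt0 ?mulr_gt0.
rewrite lnXn // lnM ?posrE // mulr2n; lra.
Qed.

(** T T^H and T^H T are similar through [T]; apply the Weyl inequality with that
    similarity. *)
Lemma eigprod_gram_swap n k (T : 'M[C]_n) : T \in unitmx -> (k <= n)%N ->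
  eigprod k (T *m T^H) <= eigprod k (T^H *m T).
Proof.
move=> Tu kn.
have pT : posdefmx (T^H *m T) by apply: posdef_gram; apply: unit_inj.
have pT' : posdefmx (T *m T^H).
  by rewrite -{1}[T]ctK; apply: posdef_gram; apply: unit_inj; rewrite ct_unitmx.
have e : T *m (T^H *m T) = T *m T^H *m T by rewrite mulmxA.
have := eigprod_Weyl pT' Tu e kn.
rewrite (posdef_ct pT) -[X in eigprod k (X *m X)](mxpow1 pT) mxpowD //.
rewrite eigprod_mxpow ?addr_ge0 // powRD ?(gt_eqF (eigprod_gt0 pT kn)) ?implybT //.
rewrite powRr1 ?eigprod_ge0 // -expr2.
by rewrite ler_pXn2r // nnegrE eigprod_ge0.
Qed.

Section Araki.
Variables (n k : nat) (P Q : 'M[C]_n).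
Hypotheses (pP : posdefmx P) (pQ : posdefmx Q) (kn : (k <= n)%N).

Definition sandwich (t : R) : 'M[C]_n :=
  mxpow P (t / 2) *m mxpow Q t *m mxpow P (t / 2).

Lemma posdef_sandwich t : posdefmx (sandwich t).
Proof.
have := posdef_congr_unit (posdef_mxpow pQ t) (mxpow_unit pP (t / 2)).
by rewrite ct_mxpow.
Qed.

Lemma sandwich_gram t :
  (mxpow Q (t / 2) *m mxpow P (t / 2))^H *m (mxpow Q (t / 2) *m mxpow P (t / 2))
  = sandwich t.
Proof.
rewrite ctM !ct_mxpow // /sandwich -!mulmxA; congr (_ *m _).
by rewrite mulmxA mxpowD // -splitr.
Qed.

(** With L and J the products Q^(a/2) P^(a/2) and Q^(b/2) P^(b/2), the sandwich
    at the midpoint is similar to L^H J. The Weyl inequality passes to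
    J^H (L L^H) J, and the Horn inequality splits it into the two factors. *)
Lemma eigprod_sandwich_mid a b :
  eigprod k (sandwich ((a + b) / 2)) ^+ 2 <= eigprod k (sandwich a) * eigprod k (sandwich b).
Proof.
set c := (a + b) / 2.
pose J := mxpow Q (b / 2) *m mxpow P (b / 2).
pose L := mxpow Q (a / 2) *m mxpow P (a / 2).
have Ju : J \in unitmx by rewrite unitmx_mul !mxpow_unit.
have Lu : L \in unitmx by rewrite unitmx_mul !mxpow_unit.
have pL : posdefmx (L *m L^H).
  by rewrite -{1}[L]ctK; apply: posdef_gram; apply: unit_inj; rewrite ct_unitmx.
(* The exponent balances the outer powers a/2 and b/2 to (a + b)/4 each. *)
pose Z := mxpow P ((b - a) / 4).
have ZT : Z *m (L^H *m J) = sandwich c *m Z.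
  have -> : L^H *m J = mxpow P (a / 2) *m mxpow Q c *m mxpow P (b / 2).
    have -> : c = a / 2 + b / 2 by rewrite /c; field.
    by rewrite -(mxpowD pQ) /L /J ctM (ct_mxpow pQ) (ct_mxpow pP) !mulmxA.
  rewrite /sandwich /Z !mulmxA (mxpowD pP) -[in RHS]mulmxA (mxpowD pP).
  by congr (_ *m _ *m _); congr (mxpow P _); rewrite /c; field.
apply: (le_trans (eigprod_Weyl (posdef_sandwich c) (mxpow_unit pP _) ZT kn)).
have -> : (L^H *m J)^H *m (L^H *m J) = J^H *m (L *m L^H) *m J.
  by rewrite ctM ctK !mulmxA.
apply: (le_trans (eigprod_Horn pL (unit_inj Ju) kn)).
rewrite -!sandwich_gram; apply: ler_wpM2r; last exact: eigprod_gram_swap.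
apply: eigprod_ge0; rewrite sandwich_gram; exact: posdef_sandwich.
Qed.

Lemma eigprod_sandwich_le t : 0 <= t ->
  eigprod k (sandwich t) <= powR (eigprod k Q * eigprod k P) t.
Proof.
move=> t0; have := eigprod_Horn (posdef_mxpow pQ t) (unit_inj (mxpow_unit pP (t / 2))) kn.
rewrite ct_mxpow // mxpowD // -splitr !eigprod_mxpow // => /le_trans; apply.
by rewrite powRM ?eigprod_ge0.
Qed.

(** ln of the eigenvalue product of the sandwich at [t] is midpoint convex in [t],
    zero at t = 0 and bounded above on bounded intervals, so it lies below its
    chord between 0 and [q]; evaluate at t = 1. *)
Lemma Araki q : 1 <= q -> powR (eigprod k (sandwich 1)) q <= eigprod k (sandwich q).
Proof.
move=> q1; have q0 : 0 < q by lra.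
have fp t : 0 < eigprod k (sandwich t) by apply: eigprod_gt0 (posdef_sandwich t) kn.
pose g t := ln (eigprod k (sandwich t)).
pose m := eigprod k Q * eigprod k P.
have m0 : 0 < m by rewrite mulr_gt0 ?eigprod_gt0.
have g0 : g 0 = 0.
  rewrite /g /sandwich mul0r !mxpow0 // !mulmx1.
  have s1 : spectral_form 1%:M (fun=> 1) (1%:M : 'M[C]_n).
    split; last by rewrite rdiag1 // ct1 !mulmx1.
    by apply: unitary_intro; rewrite ct1 mulmx1.
  by rewrite (eigprod_spec s1) // ?big1 ?ln1.
have gmid a b : g ((a + b) / 2) <= (g a + g b) / 2.
  by apply: ln_geometric_mid (fp a) (fp b) (fp _) (eigprod_sandwich_mid a b).
have gB t : 0 <= t <= q -> g t <= q * `|ln m|.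
  move=> /andP[t0 tq]; apply: (@le_trans _ _ (t * ln m)).
    by rewrite -ln_powR ler_ln ?posrE ?powR_gt0 // eigprod_sandwich_le.
  rewrite (le_trans (ler_norm _)) // normrM ger0_norm // ler_wpM2r //.
have gE t : g t = ln (eigprod k (sandwich t)) by [].
clearbody g; have := @midconvex_le0 _ (fun t => g t - t * (g q / q)) q
  (q * `|ln m| + q * `|g q / q|).
have -> : g 0 - 0 * (g q / q) = 0 by rewrite g0 mul0r subrr.
have -> : g q - q * (g q / q) = 0 by rewrite mulrC divfK ?subrr // gt_eqF.
move=> /(_ (lexx 0) (lexx 0)) H.
have : g 1 - 1 * (g q / q) <= 0.
  apply: H => [a b|t tq|]; last by rewrite ler01 q1.
    by have := gmid a b; lra.
  rewrite lerD ?gB //; case/andP: tq => t0 tq.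
  rewrite -mulrN (le_trans (ler_norm _)) // normrM normrN ger0_norm // ler_wpM2r //.
rewrite mul1r subr_le0 ler_pdivlMr // => gq.
by rewrite -ler_ln ?posrE ?powR_gt0 // ln_powR mulrC -!gE.
Qed.

End Araki.
End Majorizations.

(** * Sums of congruences and of geometric means *)

Section Sums.
Variable R : realType.
Local Notation C := R[i].

Lemma col_mx_inj_up m1 m2 n (S : 'M[C]_(m1, n)) (T : 'M[C]_(m2, n)) :
  (forall x : 'cV_n, S *m x = 0 -> x = 0) ->
  forall x : 'cV_n, col_mx S T *m x = 0 -> x = 0.
Proof.
by move=> Sinj x; rewrite mul_col_mx => /eqP; rewrite col_mx_eq0 => /andP[/eqP/Sinj].
Qed.

Lemma bdiag_congr n (K L S T : 'M[C]_n) :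
  (col_mx S T)^H *m bdiag K L *m col_mx S T = S^H *m K *m S + T^H *m L *m T.
Proof.
by rewrite ct_col_mx /bdiag mul_row_block !mulmx0 addr0 add0r mul_row_col.
Qed.

Lemma gram_col n (S T : 'M[C]_n) :
  (col_mx S T)^H *m col_mx S T = S^H *m S + T^H *m T.
Proof. by rewrite ct_col_mx mul_row_col. Qed.

(** A pinching argument: the block diagonal matrix is the average of J J^H and
    J' J'^H, where J and J' stack the square root of [X] above plus or minus the
    square root of [Y]. Both Gram matrices J^H J and J'^H J' equal X + Y. *)
Lemma sum_eigs_bdiag n k (X Y : 'M[C]_n) : posdefmx X -> posdefmx Y ->
  (k <= n)%N ->
  \sum_(j < k) eigs (bdiag X Y) j <= \sum_(j < k) eigs (X + Y) j.
Proof.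
move=> pX pY kn; have kn2 : (k <= n + n)%N by rewrite (leq_trans kn) ?leq_addr.
have [V VV XV] := top_vectors kn2 (bdiag_posdef pX pY).
pose S := mxpow X (1 / 2); pose T := mxpow Y (1 / 2).
have SS : S *m S = X by apply: mxpow_half.
have TT : T *m T = Y by apply: mxpow_half.
have Sh : S^H = S by apply: ct_mxpow.
have Th : T^H = T by apply: ct_mxpow.
have Sinj : forall x : 'cV_n, S *m x = 0 -> x = 0 by apply/unit_inj/mxpow_unit.
clearbody S T.
have bound (Z : 'M[C]_n) : Z^H *m Z = Y ->
    \tr (V^H *m (col_mx S Z *m (col_mx S Z)^H) *m V)
      <= (\sum_(j < k) eigs (X + Y) j)%:C.
  move=> ZZ; have := sum_eigs_gram (col_mx_inj_up (T := Z) Sinj) kn VV.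
  by rewrite gram_col Sh SS ZZ.
have b1 : \tr (V^H *m (col_mx S T *m (col_mx S T)^H) *m V)
      <= (\sum_(j < k) eigs (X + Y) j)%:C by apply: bound; rewrite Th.
have NTh : (- T)^H = - T by rewrite -ctmxE linearN /= map_mxN ctmxE Th.
have b2 : \tr (V^H *m (col_mx S (- T) *m (col_mx S (- T))^H) *m V)
      <= (\sum_(j < k) eigs (X + Y) j)%:C.
  by apply: bound; rewrite NTh mulNmx mulmxN opprK.
(* The off-diagonal blocks have opposite signs and cancel. *)
have avg : col_mx S T *m (col_mx S T)^H + col_mx S (- T) *m (col_mx S (- T))^H
  = bdiag X Y + bdiag X Y.
  rewrite !ct_col_mx !mul_col_row Sh Th NTh SS TT /bdiag !add_block_mx.
  by rewrite !mulmxN !mulNmx opprK TT (subrr (S *m T)) (subrr (T *m S)) addr0.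
have := lerD b1 b2; rewrite -linearD /= -mulmxDl -mulmxDr avg.
rewrite mulmxDr mulmxDl (top_compression VV XV) linearD /= tr_rdiag -!rmorphD lecR.
by rewrite -!mulr2n lerMn2r.
Qed.

(** Let J stack the square roots of [X] and [Y]. By the Horn inequality, the
    eigenvalues of J^H K J are log-majorized by products of the eigenvalues of
    X + Y with the powers s of those of the block diagonal matrix, and the latter
    are submajorized by those of X + Y. It is applied below to the block diagonal
    of two matrices, so that J^H K J is a sum of two congruences. *)
Lemma sum_eigs_congr n k (X Y : 'M[C]_n) (K : 'M[C]_(n + n)) s :
  posdefmx X -> posdefmx Y -> posdefmx K -> 0 <= s ->
  (forall l, (l <= n)%N -> eigprod l K <= powR (eigprod l (bdiag X Y)) s) ->
  (k <= n)%N ->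
  \sum_(j < k) eigs ((col_mx (mxpow X (1 / 2)) (mxpow Y (1 / 2)))^H *m K
      *m col_mx (mxpow X (1 / 2)) (mxpow Y (1 / 2))) j
  <= \sum_(j < k) powR (eigs (X + Y) j) (1 + s).
Proof.
move=> pX pY pK s0 Ks kn; set J := col_mx _ _.
have Jinj : forall x : 'cV_n, J *m x = 0 -> x = 0.
  by apply/col_mx_inj_up/unit_inj/mxpow_unit.
have JJ : J^H *m J = X + Y.
  by rewrite /J gram_col !ct_mxpow // !mxpow_half.
clearbody J.
have [_ dE] := posdef_spectral_form (posdef_congr pK Jinj).
have [_ dXY] := posdef_spectral_form (posdefD pX pY).
have [_ dB] := posdef_spectral_form (bdiag_posdef pX pY).
have {}dB : decpos n (eigs (bdiag X Y)) by apply: decposW dB; rewrite leq_addr.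
have pos j : (j < k)%N -> 0 < eigs (X + Y) j.
  by move=> jk; apply/dXY.1/(leq_trans jk).
have posB j : (j < k)%N -> 0 < eigs (bdiag X Y) j.
  by move=> jk; apply/dB.1/(leq_trans jk).
apply: (@le_trans _ _ (\sum_(j < k) eigs (X + Y) j * powR (eigs (bdiag X Y) j) s)).
  apply: (@logmaj_sum _ k (eigs _) (fun j => eigs (X + Y) j * powR (eigs (bdiag X Y) j) s)).
  - exact: decposW dE.
  - by move=> j jk; rewrite mulr_gt0 ?powR_gt0 ?pos ?posB.
  move=> l lk; have ln := leq_trans lk kn; rewrite big_split /= -prod_powR; last first.
    by move=> j jl; apply: posB; apply: leq_trans lk.
  apply: (le_trans (eigprod_Horn pK Jinj ln)); rewrite JJ mulrC.
  by apply: ler_wpM2l (Ks l ln); apply/eigprod_ge0/posdefD.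
apply: submaj_weighted_powR => //; first exact: decposW dB.
by move=> l lk; apply: sum_eigs_bdiag => //; apply: leq_trans kn.
Qed.

(** X^r is X^(1/2) X^(r-1) X^(1/2), so the sum of the two powers is a sum of
    congruences of X^(r-1) and Y^(r-1). *)
Lemma sum_eigs_power_sum n k (X Y : 'M[C]_n) r :
  posdefmx X -> posdefmx Y -> 1 <= r -> (k <= n)%N ->
  \sum_(j < k) eigs (mxpow X r + mxpow Y r) j
  <= \sum_(j < k) powR (eigs (X + Y) j) r.
Proof.
move=> pX pY r1 kn; have s0 : 0 <= r - 1 by rewrite subr_ge0.
have pK := bdiag_posdef (posdef_mxpow pX (r - 1)) (posdef_mxpow pY (r - 1)).
have := @sum_eigs_congr n k X Y _ (r - 1) pX pY pK s0 _ kn.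
rewrite bdiag_congr !ct_mxpow // !mxpowD //.
have -> : 1 / 2 + (r - 1) + 1 / 2 = r by field.
have -> : 1 + (r - 1) = r by ring.
apply=> l ln; have pXY := bdiag_posdef pX pY.
by rewrite -(mxpow_bdiag _ pX pY) (eigprod_mxpow pXY s0 (leq_trans ln (leq_addr _ _))).
Qed.

(** The Riccati equation G A^(-1) G = B characterizes the geometric mean among
    positive definite matrices, and is easier to transform than the formula with
    square roots. *)
Lemma geomean_spec n (A B : 'M[C]_n) : posdefmx A -> posdefmx B ->
  posdefmx (geomean A B) /\ geomean A B *m mxpow A (- 1) *m geomean A B = B.
Proof.
move=> pA pB; rewrite /geomean !mxpowE.
set S := mxpow A (1 / 2); set S' := mxpow A (- (1 / 2)).
have SS' : S *m S' = 1%:M by apply: mxpowNK.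
have S'S : S' *m S = 1%:M by apply: mxpowKN.
have S'h : S'^H = S' by apply: ct_mxpow.
have Sh : S^H = S by apply: ct_mxpow.
have Su : S \in unitmx by apply: mxpow_unit.
have S'u : S' \in unitmx by apply: mxpow_unit.
have AE : mxpow A (-1) = S' *m S'.
  by rewrite mxpowD //; congr (mxpow A _); field.
clearbody S S'; set M := S' *m B *m S'.
have pM : posdefmx M by rewrite /M -{1}S'h; apply: posdef_congr_unit.
have MM := mxpow_half pM; have pMh := posdef_mxpow pM (1 / 2).
move: (mxpow M (1 / 2)) MM pMh => W WW pW.
split; first by rewrite -{1}Sh; apply: posdef_congr_unit.
have -> : S *m W *m S *m mxpow A (-1) *m (S *m W *m S)
        = S *m W *m (S *m S') *m (S' *m S) *m W *m S by rewrite AE !mulmxA.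
rewrite SS' S'S !mulmx1 -[S *m W *m W]mulmxA WW /M.
by rewrite !mulmxA SS' mul1mx -mulmxA S'S mulmx1.
Qed.

(** Here [G] is the geometric mean of [A] and [B], [X] that of their squares, and
    [A'] the inverse of [A]. Conjugating G^(-1/2) X G^(-1/2) by G^(-1/2) A gives
    T = A^(-1) X G^(-1) A, and the two Riccati equations turn T^H T into G^2.
    Stated with [A'] as a parameter, the lemma applies to block diagonal
    matrices without computing their inverses. *)
Lemma eigprod_Riccati_sqr n k (A A' B G X : 'M[C]_n) :
  posdefmx A -> posdefmx B -> posdefmx G -> posdefmx X ->
  A' *m A = 1%:M -> G *m A' *m G = B -> X *m (A' *m A') *m X = B *m B ->
  (k <= n)%N ->
  eigprod k (mxpow G (- (1 / 2)) *m X *m mxpow G (- (1 / 2))) <= eigprod k G.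
Proof.
move=> pA pB pG pX A'A GG XX kn.
set S := mxpow G _.
have Sh : S^H = S by apply: ct_mxpow.
have Su : S \in unitmx by apply: mxpow_unit.
have SS : S *m S = invmx G.
  rewrite mxpowD // -opprD -splitr -[RHS]mul1mx -(mxpowKN pG 1) (mxpow1 pG).
  by rewrite mulmxK // posdef_unit.
have Gu := posdef_unit pG; have AA' := mulmx1C A'A.
have pK : posdefmx (S *m X *m S) by rewrite -{1}Sh; apply: posdef_congr_unit.
have A'h : A'^H = A'.
  have : A'^H *m A = A' *m A.
    by rewrite A'A -[A in LHS](posdef_ct pA) -ctM AA' ct1.
  by move/(congr1 (mulmx^~ A')); rewrite -!mulmxA AA' !mulmx1.
have Gih : (invmx G)^H = invmx G by rewrite -SS ctM Sh.
clearbody S.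
pose T := A' *m X *m invmx G *m A.
have ZT : S *m A *m T = S *m X *m S *m (S *m A).
  by rewrite /T !mulmxA -[S *m A *m A']mulmxA AA' mulmx1 -[_ *m S *m S]mulmxA SS.
have BGA : B *m invmx G *m A = G.
  by rewrite -GG mulmxK // -mulmxA A'A mulmx1.
have AGB : A *m invmx G *m B = G.
  rewrite -[RHS](posdef_ct pG) -[in RHS]BGA !ctM Gih.
  by rewrite (posdef_ct pA) (posdef_ct pB) mulmxA.
have TT : T^H *m T = G *m G.
  rewrite /T !ctM Gih A'h (posdef_ct pA) (posdef_ct pX).
  have -> : A *m (invmx G *m (X *m A')) *m (A' *m X *m invmx G *m A)
    = A *m invmx G *m (X *m (A' *m A') *m X) *m invmx G *m A by rewrite !mulmxA.
  by rewrite XX !mulmxA AGB -(mulmxA G) -(mulmxA G) BGA.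
have Zu : S *m A \in unitmx by rewrite unitmx_mul Su posdef_unit.
have := eigprod_Weyl pK Zu ZT kn.
rewrite TT -[X in eigprod k (X *m X)](mxpow1 pG) mxpowD // eigprod_mxpow ?addr_ge0 //.
rewrite powRD ?(gt_eqF (eigprod_gt0 pG kn)) ?implybT // powRr1 ?eigprod_ge0 // -expr2.
by rewrite ler_pXn2r // nnegrE eigprod_ge0.
Qed.

(** Each mean of squares is G^(1/2) K G^(1/2), where by the previous lemma the
    leading eigenvalue products of [K] are at most those of [G]. The comparison is
    made on the block diagonal level, so that the two means are handled at once. *)
Lemma sum_eigs_geomean_sqr n k (A B A2 B2 : 'M[C]_n) :
  posdefmx A -> posdefmx B -> posdefmx A2 -> posdefmx B2 -> (k <= n)%N ->
  \sum_(j < k) eigs (geomean (A *m A) (B *m B) + geomean (A2 *m A2) (B2 *m B2)) j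
  <= \sum_(j < k) powR (eigs (geomean A B + geomean A2 B2) j) 2.
Proof.
move=> pA pB pA2 pB2 kn.
have [pG GG] := geomean_spec pA pB; have [pH HH] := geomean_spec pA2 pB2.
have [pX XX] := geomean_spec (posdef_sqr pA) (posdef_sqr pB).
have [pY YY] := geomean_spec (posdef_sqr pA2) (posdef_sqr pB2).
move: pG GG pH HH pX XX pY YY.
move: (geomean A B) (geomean A2 B2) => G H.
move: (geomean (A *m A) _) (geomean (A2 *m A2) _) => X Y pG GG pH HH pX XX pY YY.
have sq (M : 'M[C]_n) : posdefmx M -> mxpow (M *m M) (-1) = mxpow M (-1) *m mxpow M (-1).
  move=> pM; rewrite -{1 2}(mxpow1 pM) !mxpowD // mxpowM //.
  by congr (mxpow M _); ring.
pose inv2 (M : 'M[C]_n) := mxpow M (- (1 / 2)).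
pose K := inv2 G *m X *m inv2 G; pose L := inv2 H *m Y *m inv2 H.
have pK : posdefmx K.
  by rewrite /K /inv2 -{1}(ct_mxpow pG); apply: posdef_congr_unit => //; apply: mxpow_unit.
have pL : posdefmx L.
  by rewrite /L /inv2 -{1}(ct_mxpow pH); apply: posdef_congr_unit => //; apply: mxpow_unit.
have := @sum_eigs_congr n k G H (bdiag K L) 1 pG pH (bdiag_posdef pK pL) ler01 _ kn.
have cancel (M Z : 'M[C]_n) : posdefmx M ->
    (mxpow M (1 / 2))^H *m (mxpow M (- (1 / 2)) *m Z *m mxpow M (- (1 / 2))) *m mxpow M (1 / 2) = Z.
  move=> pM; rewrite ct_mxpow // !mulmxA mxpowNK // mul1mx -mulmxA mxpowKN //.
  by rewrite mulmx1.
rewrite bdiag_congr !cancel //; apply=> l ln.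
have lnn : (l <= n + n)%N by rewrite (leq_trans ln) ?leq_addr.
rewrite powRr1 ?eigprod_ge0 //; last exact: bdiag_posdef.
have -> : bdiag K L = mxpow (bdiag G H) (- (1 / 2)) *m bdiag X Y *m mxpow (bdiag G H) (- (1 / 2)).
  by rewrite mxpow_bdiag // !bdiagM.
apply: (@eigprod_Riccati_sqr _ l (bdiag A A2) (bdiag (mxpow A (-1)) (mxpow A2 (-1)))
  (bdiag B B2)) => //; try exact: bdiag_posdef.
- by rewrite bdiagM -{2}(mxpow1 pA) -{2}(mxpow1 pA2) !mxpowKN // bdiag1.
- by rewrite !bdiagM GG HH.
- by rewrite !bdiagM -!sq // XX YY.
Qed.

End Sums.

(** * A Cauchy-Schwarz inequality for eigenvalue products *)

Section Cauchy.
Variable R : realType.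
Local Notation C := R[i].

(** All eigenvalues of [M] are at most one, because 1 - M is a Gram matrix and so
    has nonnegative diagonal entries in an eigenbasis of [M]. *)
Lemma eigprod_le1 n p k (M : 'M[C]_n) (W : 'M[C]_(n, p)) : posdefmx M ->
  1%:M - M = W *m W^H -> (k <= n)%N -> eigprod k M <= 1.
Proof.
move=> pM MW kn; have [V VV MV] := top_vectors (leqnn n) pM.
have e : 1%:M - rdiag n (eigs M) = V^H *m W *m (V^H *m W)^H.
  rewrite -(top_compression VV MV) -VV ctM ctK.
  have -> : V^H *m W *m (W^H *m V) = V^H *m (W *m W^H) *m V by rewrite !mulmxA.
  by rewrite -MW mulmxBr mulmx1 mulmxBl.
apply: prodr_ile1 => j _; rewrite eigs_ge0 //=.
have jn := leq_trans (ltn_ord j) kn.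
have := gram_ge0 (V^H *m W) (Ordinal jn); rewrite -e !mxE eqxx mulr1n.
by rewrite subr_ge0 -lecR.
Qed.

(** Write P, Q, F for the three sums. The Riccati map (G, A) to G A^(-1) G is
    jointly convex, so F P^(-1) F <= Q, which says that the compression
    Q^(-1/2) F P^(-1) F Q^(-1/2) is at most the identity. On the other hand
    [F] is similar to T = P^(-1/2) F P^(1/2), and T^H T is the congruence of that
    contraction by Q^(1/2) P^(1/2). *)
Lemma eigprod_Riccati_sum n k (A B G A2 B2 G2 : 'M[C]_n) :
  posdefmx A -> posdefmx A2 -> posdefmx G -> posdefmx G2 ->
  posdefmx (B + B2) ->
  G *m mxpow A (- 1) *m G = B -> G2 *m mxpow A2 (- 1) *m G2 = B2 ->
  (k <= n)%N ->
  eigprod k (G + G2) ^+ 2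
    <= eigprod k (mxpow (A + A2) (1 / 2) *m (B + B2) *m mxpow (A + A2) (1 / 2)).
Proof.
move=> pA pA2 pG pG2 pQ GG GG2 kn.
have pP := posdefD pA pA2; have pF := posdefD pG pG2.
have [P PE] : exists P, A + A2 = P by exists (A + A2).
have [Q QE] : exists Q, B + B2 = Q by exists (B + B2).
have [F FE] : exists F, G + G2 = F by exists (G + G2).
rewrite PE in pP *; rewrite QE in pQ *; rewrite FE in pF *.
have Ph s : (mxpow P s)^H = mxpow P s by apply: ct_mxpow.
have Qh s : (mxpow Q s)^H = mxpow Q s by apply: ct_mxpow.
have Fh : F^H = F by apply: posdef_ct.
pose T := mxpow P (- (1 / 2)) *m F *m mxpow P (1 / 2).
have ZT : mxpow P (1 / 2) *m T = F *m mxpow P (1 / 2).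
  by rewrite /T !mulmxA mxpowNK // mul1mx.
apply: (le_trans (eigprod_Weyl pF (mxpow_unit pP _) ZT kn)).
pose Pi := mxpow P (-1).
have Pih : Pi^H = Pi by apply: ct_mxpow.
have PiE : mxpow P (- (1 / 2)) *m mxpow P (- (1 / 2)) = Pi.
  by rewrite mxpowD // -opprD -splitr.
have PPi : P *m Pi = 1%:M by rewrite -{1}(mxpow1 pP) mxpowNK.
have pPi : posdefmx Pi by apply: posdef_mxpow.
clearbody Pi.
pose S := mxpow Q (- (1 / 2)).
pose J := mxpow Q (1 / 2) *m mxpow P (1 / 2).
have Su : S \in unitmx by apply: mxpow_unit.
have Sh : S^H = S by apply: ct_mxpow.
have QS : mxpow Q (1 / 2) *m S = 1%:M by apply: mxpowNK.
have SQ : S *m mxpow Q (1 / 2) = 1%:M by apply: mxpowKN.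
have SQS : S *m Q *m S = 1%:M.
  by rewrite -(mxpow_half pQ) !mulmxA SQ mul1mx QS.
clearbody S; pose M := S *m (F *m Pi *m F) *m S.
have pM : posdefmx M.
  have p1 : posdefmx (F^H *m Pi *m F) by apply: posdef_congr_unit => //; apply: posdef_unit.
  rewrite Fh in p1; rewrite /M -{1}Sh; exact: posdef_congr_unit p1 Su.
have -> : T^H *m T = J^H *m M *m J.
  have QSK (Z : 'M[C]_n) : mxpow Q (1 / 2) *m (S *m Z) = Z by rewrite mulmxA QS mul1mx.
  have SQK (Z : 'M[C]_n) : S *m (mxpow Q (1 / 2) *m Z) = Z by rewrite mulmxA SQ mul1mx.
  rewrite /T /J /M !ctM !Ph Qh Fh -!mulmxA QSK SQK.
  by rewrite (mulmxA (mxpow P (- (1 / 2)))) PiE.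
have Ju : J \in unitmx by rewrite unitmx_mul !mxpow_unit.
apply: (le_trans (eigprod_Horn pM (unit_inj Ju) kn)).
have -> : J^H *m J = mxpow P (1 / 2) *m Q *m mxpow P (1 / 2).
  by rewrite /J ctM Ph Qh -{3}(mxpow_half pQ) !mulmxA.
have pPQ : posdefmx (mxpow P (1 / 2) *m Q *m mxpow P (1 / 2)).
  by rewrite -{1}Ph; apply: posdef_congr_unit => //; apply: mxpow_unit.
rewrite -[leRHS]mul1r; apply: ler_wpM2r; first exact: eigprod_ge0.
pose Y := Pi *m F.
have YF : P *m Y = F by rewrite /Y mulmxA PPi mul1mx.
(* The forms D^H A D and D^H A2 D of the two defects D add up to Q - F P^(-1) F,
   which is thus a sum of two Gram matrices. *)
pose defect (A0 G0 : 'M[C]_n) := mxpow A0 (- 1) *m G0 - Y.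
have defectE (A0 G0 : 'M[C]_n) : posdefmx A0 -> posdefmx G0 ->
    (defect A0 G0)^H *m A0 *m defect A0 G0
    = G0 *m mxpow A0 (-1) *m G0 - G0 *m Y - Y^H *m G0 + Y^H *m A0 *m Y.
  move=> pA0 pG0; have A0i : mxpow A0 (-1) *m A0 = 1%:M.
    by rewrite -{2}(mxpow1 pA0) mxpowKN.
  have A0i' := mulmx1C A0i.
  rewrite /defect ctB ctM (posdef_ct pG0) ct_mxpow // !mulmxBl.
  rewrite -[G0 *m _ *m A0]mulmxA A0i mulmx1 !mulmxBr !mulmxA.
  rewrite -[Y^H *m A0 *m _]mulmxA A0i' mulmx1.
  move: (_ *m G0) (G0 *m Y) (Y^H *m G0) (Y^H *m A0 *m Y) => a b c d.
  by apply/matrixP => i j; rewrite !mxE; ring.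
clearbody defect; pose W0 (A0 G0 : 'M[C]_n) := (mxpow A0 (1 / 2) *m defect A0 G0 *m S)^H.
apply: (@eigprod_le1 _ _ _ _ (row_mx (W0 A G) (W0 A2 G2))) => //.
have WE (A0 G0 : 'M[C]_n) : posdefmx A0 ->
    W0 A0 G0 *m (W0 A0 G0)^H = S *m ((defect A0 G0)^H *m A0 *m defect A0 G0) *m S.
  move=> pA0; rewrite /W0 ctK !ctM Sh ct_mxpow // !mulmxA.
  by rewrite -[X in X *m _ *m S](mulmxA _ (mxpow A0 _)) mxpow_half.
rewrite ct_row_mx mul_row_col !WE // -mulmxDl -mulmxDr !defectE // GG GG2.
have -> : B - G *m Y - Y^H *m G + Y^H *m A *m Y + (B2 - G2 *m Y - Y^H *m G2 + Y^H *m A2 *m Y)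
   = Q - F *m Y - Y^H *m F + Y^H *m P *m Y.
  rewrite -QE -FE -PE mulmxDl !mulmxDr mulmxDl.
  move: (G *m Y) (G2 *m Y) (Y^H *m G) (Y^H *m G2) (Y^H *m A *m Y) (Y^H *m A2 *m Y).
  move=> a b c d e f; apply/matrixP => i j; rewrite !mxE; ring.
rewrite -[Y^H *m P *m Y]mulmxA YF addrNK.
by rewrite mulmxBr mulmxBl SQS /M /Y !mulmxA.
Qed.

End Cauchy.

(** * Symmetric gauge functions *)

Section Gauge.
Variables (R : realType) (n : nat).

Definition flip_sign (i : 'I_n) (x : 'rV[R]_n) : 'rV[R]_n :=
  \row_l (if l == i then - x 0 l else x 0 l).

Variable f : 'rV[R]_n -> R.
Hypothesis f_convex : forall (t : R) (x y : 'rV[R]_n), 0 <= t <= 1 ->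
  f (t *: x + (1 - t) *: y) <= t * f x + (1 - t) * f y.
Hypothesis f_perm : forall i j x, f (xcol i j x) = f x.
Hypothesis f_sign : forall i x, f (flip_sign i x) = f x.

Definition set_coord (y : 'rV[R]_n) i (a : R) : 'rV[R]_n :=
  \row_l (if l == i then a else y 0 l).

(** The shrunken vector lies between [y] and its reflection in one coordinate. *)
Lemma gauge_shrink (y : 'rV[R]_n) i a : 0 <= a < y 0 i ->
  f (set_coord y i a) <= f y.
Proof.
move=> /andP[a0 ay]; have y0 : 0 < y 0 i by apply: le_lt_trans ay.
(* The weight solving t y - (1 - t) y = a in the i-th coordinate. *)
pose t := (1 + a / y 0 i) / 2.
have u0 : 0 <= a / y 0 i by rewrite divr_ge0 // ltW.
have u1 : a / y 0 i <= 1 by rewrite ler_pdivrMr // mul1r ltW.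
have -> : set_coord y i a = t *: y + (1 - t) *: flip_sign i y.
  apply/rowP => l; rewrite !mxE; case: eqP => [->|_].
    by rewrite /t; field; rewrite gt_eqF.
  by ring.
apply: (le_trans (f_convex _ _ _)); first by rewrite /t; lra.
by rewrite f_sign; lra.
Qed.

Definition transfer (y : 'rV[R]_n) i j (e : R) : 'rV[R]_n :=
  \row_l (if l == i then y 0 i - e else if l == j then y 0 j + e else y 0 l).

(** Moving a small amount from a large coordinate to a small one gives a convex
    combination of [y] and of the vector with these two coordinates exchanged. *)
Lemma gauge_transfer (y : 'rV[R]_n) i j e : i != j ->
  0 < e -> e <= y 0 i - y 0 j -> f (transfer y i j e) <= f y.
Proof.
move=> ij e0 ey; have d0 : 0 < y 0 i - y 0 j by apply: lt_le_trans ey.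
pose u := e / (y 0 i - y 0 j).
have u0 : 0 <= u by rewrite divr_ge0 // ltW.
have u1 : u <= 1 by rewrite ler_pdivrMr // mul1r.
have -> : transfer y i j e = (1 - u) *: y + (1 - (1 - u)) *: xcol i j y.
  apply/rowP => l; rewrite !mxE.
  have [->|li] := eqVneq l i.
    by rewrite tpermL /u; field; rewrite gt_eqF.
  have [->|lj] := eqVneq l j.
    by rewrite tpermR /u; field; rewrite gt_eqF.
  by rewrite tpermD 1?eq_sym //; ring.
apply: (le_trans (f_convex _ _ _)); first by lra.
by rewrite f_perm; lra.
Qed.

(** Induction on the number of coordinates where the vectors differ. If [x]
    exceeds [y] somewhere, take the first such index j; an earlier index i has
    x i < y i, as otherwise a prefix sum of [x] would be too large. Transfer from i
    to j until one of the two coordinates agrees with [x]. If [x] exceeds [y]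
    nowhere, shrink a coordinate of [y] instead. *)
Lemma gauge_submaj (x y : 'rV[R]_n) :
  (forall i, 0 <= x 0 i) ->
  (forall i j : 'I_n, (i <= j)%N -> x 0 j <= x 0 i) ->
  (forall k, (k <= n)%N ->
     \sum_(i < n | (i < k)%N) x 0 i <= \sum_(i < n | (i < k)%N) y 0 i) ->
  f x <= f y.
Proof.
move=> x0 xdec; move: {-1}(#|_|) (leqnn #|[set i | x 0 i != y 0 i]|) => m.
elim: m y => [|m IH] y.
  rewrite leqn0 cards_eq0 => /eqP xy _.
  have -> // : x = y; apply/rowP => i; apply/eqP; apply: negbNE.
  by have := in_set0 i; rewrite -xy inE => ->.
move=> card_m maj.
have card_lt (z : 'rV[R]_n) i : x 0 i != y 0 i -> x 0 i = z 0 i ->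
    (forall l : 'I_n, x 0 l = y 0 l -> x 0 l = z 0 l) ->
    leq #|[set l : 'I_n | x 0 l != z 0 l]| m.
  move=> xyi xzi zl; rewrite -ltnS; apply: leq_trans card_m; apply: proper_card.
  apply/properP; split.
    by apply/subsetP => l; rewrite !inE; apply: contra_neq => /zl.
  by exists i; rewrite !inE ?xyi // xzi eqxx.
case: (pickP (fun j : 'I_n => y 0 j < x 0 j)) => [j0 yxj0|le_xy]; last first.
  have {}le_xy (l : 'I_n) : x 0 l <= y 0 l by rewrite leNgt le_xy.
  case: (pickP (fun i : 'I_n => x 0 i < y 0 i)) => [i xyi|ge_xy]; last first.
    have -> // : x = y.
    by apply/rowP => l; apply/eqP; rewrite eq_le le_xy leNgt ge_xy.
  apply: (@le_trans _ _ (f (set_coord y i (x 0 i)))); last first.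
    by apply: gauge_shrink; rewrite x0.
  apply: IH => [|k kn].
    apply: (card_lt _ i); rewrite ?lt_eqF // ?mxE ?eqxx // => l.
    by rewrite mxE; case: eqP => // ->.
  by apply: ler_sum => l _; rewrite mxE; case: eqP => // ->.
pose j := [arg min_(j < j0 | (y 0 j < x 0 j)%R) (j : nat)]%N.
have [yxj jmin] : y 0 j < x 0 j /\ forall l : 'I_n, (l < j)%N -> x 0 l <= y 0 l.
  rewrite /j; case: arg_minnP => // i yxi imin; split=> // l li.
  by rewrite leNgt; apply/negP => /imin; rewrite leqNgt li.
case: (pickP (fun i : 'I_n => (i < j)%N && (x 0 i < y 0 i))) => [i|none]; last first.
  have := maj j.+1 (ltn_ord j); rewrite leNgt; case/negP.
  rewrite (bigD1 j) //= [ltRHS](bigD1 j) //=; apply: ltr_leD => //.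
  apply: ler_sum => l /andP[]; rewrite ltnS leq_eqVlt -val_eqE => /orP[->//|lj _].
  by rewrite leNgt; have := none l; rewrite lj /= => ->.
move=> /andP[ij xyi].
have neq_ij : i != j by rewrite -val_eqE neq_ltn ij.
pose e := Num.min (y 0 i - x 0 i) (x 0 j - y 0 j).
have e1 : e <= y 0 i - x 0 i by rewrite ge_min lexx.
have e2 : e <= x 0 j - y 0 j by rewrite ge_min lexx orbT.
have e0 : 0 < e by rewrite lt_min !subr_gt0 xyi.
have xij := xdec _ _ (ltnW ij).
apply: (@le_trans _ _ (f (transfer y i j e))); last first.
  by apply: gauge_transfer => //; lra.
have tE (l : 'I_n) : transfer y i j e 0 l = y 0 l + (if l == j then e else 0) - (if l == i then e else 0).
  rewrite mxE; have [->|li] := eqVneq l i; first by rewrite (negPf neq_ij); ring.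
  by have [->|lj] := eqVneq l j; ring.
apply: IH => [|k kn].
  have eq_l (l : 'I_n) : x 0 l = y 0 l -> x 0 l = transfer y i j e 0 l.
    move=> xyl; rewrite tE; case: eqP => [lj|_]; first by move: yxj; rewrite -lj xyl ltxx.
    by case: eqP => [li|_]; [move: xyi; rewrite -li xyl ltxx | rewrite xyl; ring].
  have [le_e|lt_e] := leP (y 0 i - x 0 i) (x 0 j - y 0 j).
    have eE : e = y 0 i - x 0 i by rewrite /e min_l.
    apply: (card_lt _ i) => //; first by rewrite lt_eqF.
    by rewrite tE eqxx (negPf neq_ij) eE; ring.
  have eE : e = x 0 j - y 0 j by rewrite /e min_r // ltW.
  apply: (card_lt _ j) => //; first by rewrite gt_eqF.
  by rewrite tE eqxx eq_sym (negPf neq_ij) eE; ring.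
have [kj|jk] := leqP k j.
  apply: ler_sum => l lk; have lj := leq_trans lk kj.
  rewrite tE -val_eqE (ltn_eqF lj) addr0; case: eqP => [->|_]; first by lra.
  by rewrite subr0 jmin.
under [leRHS]eq_bigr => l _ do rewrite tE.
rewrite sumrB big_split /= -!big_mkcondr /=.
have one (h : 'I_n) : (h < k)%N -> \sum_(l < n | (l < k)%N && (l == h)) e = e.
  move=> hk; rewrite (big_pred1 h) // => l.
  by have [->|lh] := eqVneq l h; rewrite ?hk ?andbF /= ?eqxx // (negPf lh).
rewrite !one // ?addrK ?maj //; exact: ltn_trans jk.
Qed.

End Gauge.

(** * Dominance for unitarily invariant norms *)

Section Norms.
Variables (R : realType) (n : nat) (N : 'M[R[i]]_n -> R).
Hypotheses (hN : mxnorm N) (hNU : unitarily_invariant N).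
Local Notation C := R[i].

(** The symmetric gauge function of the norm. *)
Definition diag_gauge (x : 'rV[R]_n) : R := N (diag_mx (map_mx (real_complex R) x)).

Lemma mxnorm_scale (t : R) X : 0 <= t -> N (t%:C *: X) = t * N X.
Proof.
move=> t0; rewrite (mxnorm_homogeneous hN) /ComplexField.Normc.normc /=.
by rewrite expr0n addr0 sqrtr_sqr ger0_norm.
Qed.

Lemma diag_gauge_convex t x y : 0 <= t <= 1 ->
  diag_gauge (t *: x + (1 - t) *: y) <= t * diag_gauge x + (1 - t) * diag_gauge y.
Proof.
move=> /andP[t0 t1]; rewrite /diag_gauge -!mxnorm_scale ?subr_ge0 //.
apply: le_trans (mxnorm_triangle hN _ _).
by rewrite map_mxD !map_mxZ linearD /= !linearZ.
Qed.

Lemma unitary1 : 1%:M \is @unitarymx C n n.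
Proof. by apply: unitary_intro; rewrite ct1 mulmx1. Qed.

Lemma diag_gauge_perm i j x : diag_gauge (xcol i j x) = diag_gauge x.
Proof.
have Pu : tperm_mx i j \is @unitarymx C n n.
  apply: unitary_intro; apply: mulmx1C.
  have -> : (tperm_mx i j : 'M[C]_n)^H = tperm_mx i j.
    by rewrite -ctmxE tr_perm_mx tpermV map_perm_mx.
  by rewrite /tperm_mx -perm_mxM tperm2 perm_mx1.
rewrite /diag_gauge -[RHS](hNU _ Pu Pu); congr N.
rewrite -xrowE -xcolE; apply/matrixP => k l.
by rewrite !mxE (inj_eq perm_inj).
Qed.

Lemma diag_gauge_sign i x : diag_gauge (flip_sign i x) = diag_gauge x.
Proof.
pose s l : R := if l == i :> nat then -1 else 1.
have Su : rdiag n s \is unitarymx.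
  apply: unitary_intro; rewrite ct_rdiag rdiagM rdiag1 // => l _.
  by rewrite /s; case: eqP; rewrite ?mulrNN mulr1.
rewrite /diag_gauge -[RHS](hNU _ Su unitary1) mulmx1; congr N.
rewrite /rdiag mulmx_diag; congr diag_mx; apply/rowP => l; rewrite !mxE /s.
by rewrite -val_eqE; case: eqP => _; rewrite -rmorphM ?mulN1r ?mul1r.
Qed.

Lemma norm_eigs A : posdefmx A -> N A = diag_gauge (\row_(j < n) eigs A j).
Proof.
move=> pA; have [[U [Uu AU]] _] := posdef_spectral_form pA.
have Uu' : U^H \is unitarymx.
  by apply: unitary_intro; rewrite ctK (unitaryP Uu).1.
rewrite {1}AU (hNU _ Uu' Uu) /diag_gauge /rdiag; congr (N (diag_mx _)).
by apply/rowP => l; rewrite !mxE.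
Qed.

(** The dominance theorem of Ky Fan, for positive definite matrices: the norm is
    the symmetric gauge function of the norm at the ordered eigenvalues. *)
Lemma Fan_dominance A B : posdefmx A -> posdefmx B ->
  (forall k, (k <= n)%N -> \sum_(j < k) eigs A j <= \sum_(j < k) eigs B j) ->
  N A <= N B.
Proof.
move=> pA pB AB; rewrite !norm_eigs //; have [_ [Ap Ad]] := posdef_spectral_form pA.
apply: gauge_submaj.
- exact: diag_gauge_convex.
- exact: diag_gauge_perm.
- exact: diag_gauge_sign.
- by move=> i; rewrite mxE eigs_ge0.
- by move=> i j ij; rewrite !mxE Ad.
move=> k kn; have sumE (M : 'M[C]_n) :
    \sum_(i < n | (i < k)%N) (\row_(j < n) eigs M j) 0 i = \sum_(j < k) eigs M j.
  by rewrite (big_ord_widen n (eigs M) kn); apply: eq_bigr => i _; rewrite mxE.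
by rewrite !sumE AB.
Qed.

End Norms.

(** * The norm inequality for sums of geometric means *)

Theorem corollary3p5 (R : realType) (n : nat) (A B C D : 'M[R[i]]_n) (p r : R)
    (hA : posdefmx A) (hB : posdefmx B) (hC : posdefmx C) (hD : posdefmx D)
    (hp : 1 <= p) (hr : 1 <= r)
    (N : 'M[R[i]]_n -> R) (hN : mxnorm N) (hNU : unitarily_invariant N) :
  N (powmx (geomean (A *m A) (B *m B)) r + powmx (geomean (C *m C) (D *m D)) r)
  <= N (powmx (powmx (A + C) (r * p / 2)
                 *m powmx (B + D) (r * p)
                 *m powmx (A + C) (r * p / 2)) (1 / p)).
Proof.
have [pX _] := geomean_spec (posdef_sqr hA) (posdef_sqr hB).
have [pY _] := geomean_spec (posdef_sqr hC) (posdef_sqr hD).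
have [pG GG] := geomean_spec hA hB; have [pH HH] := geomean_spec hC hD.
have geomean_sqr k := @sum_eigs_geomean_sqr R n k A B C D hA hB hC hD.
move: pG GG pH HH pX pY geomean_sqr.
move: (geomean A B) (geomean C D) => G H.
move: (geomean (A *m A) _) (geomean (C *m C) _) => X Y pG GG pH HH pX pY geomean_sqr.
have pP := posdefD hA hC; have pQ := posdefD hB hD.
have Riccati k := @eigprod_Riccati_sum R n k A B G C D H hA hC pG pH pQ GG HH.
move: (A + C) (B + D) pP pQ Riccati => P Q pP pQ Riccati.
rewrite !mxpowE -/(sandwich P Q (r * p)).
have p0 : 0 < p by lra.
have r0 : 0 <= r by lra.
have ip0 : 0 <= 1 / p by rewrite divr_ge0 // ltW.
have rp1 : 1 <= r * p by rewrite mulr_ege1.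
have pM := posdef_sandwich pP pQ (r * p).
have pM1 := posdef_sandwich pP pQ 1.
have Araki_PQ k kn := @Araki R n k P Q pP pQ kn (r * p) rp1.
have S1 : sandwich P Q 1 = mxpow P (1 / 2) *m Q *m mxpow P (1 / 2).
  by rewrite /sandwich mxpow1.
move: (sandwich P Q 1) (sandwich P Q (r * p)) S1 pM pM1 Araki_PQ => M1 M S1 pM pM1 Araki_PQ.
have pLHS := posdefD (posdef_mxpow pX r) (posdef_mxpow pY r).
apply: (Fan_dominance hN hNU pLHS (posdef_mxpow pM (1 / p))) => k kn.
apply: (le_trans (sum_eigs_power_sum pX pY hr kn)).
have [_ dF] := posdef_spectral_form (posdefD pG pH).
have [_ dXY] := posdef_spectral_form (posdefD pX pY).
have [_ dM] := posdef_spectral_form (posdef_mxpow pM (1 / p)).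
have dF2 := decpos_powR (ler0n R 2) dF.
have dF2r := decpos_powR r0 dF2.
have F0 (j : nat) : (j < k)%N -> 0 < eigs (G + H) j.
  by move=> jk; apply/dF.1/(leq_trans jk).
apply: (@le_trans _ _ (\sum_(j < k) powR (powR (eigs (G + H) j) 2) r)).
  apply: (submaj_powR (y := fun j => powR (eigs (G + H) j) 2) hr (decposW kn dXY)).
    by move=> j jk; rewrite powR_gt0 // F0.
  by move=> l lk; apply: geomean_sqr; apply: leq_trans lk kn.
apply: (logmaj_sum (y := eigs _) (decposW kn dF2r)).
  by move=> j jk; apply/dM.1/(leq_trans jk).
move=> l lk; have ln := leq_trans lk kn.
rewrite -[leRHS]/(eigprod l _) (eigprod_mxpow pM ip0 ln).
have F0' j : (j < l)%N -> 0 < eigs (G + H) j by move=> jl; apply/F0/(leq_trans jl).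
have -> : \prod_(j < l) powR (powR (eigs (G + H) j) 2) r = powR (powR (eigprod l (G + H)) 2) r.
  rewrite /eigprod prod_powR // -(prod_powR (d := fun j => powR (eigs (G + H) j) 2)) //.
  by move=> j /F0' Fj; rewrite powR_gt0.
(* It remains to take the power 1 / p of eigprod M1 ^ (r p) <= eigprod M. *)
have rE : r = (r * p) * (1 / p) by field; rewrite gt_eqF.
rewrite {1}rE powRrM.
have kM1 : 0 <= eigprod l M1 by apply: eigprod_ge0.
have kM : 0 <= eigprod l M by apply: eigprod_ge0.
have kF : 0 <= eigprod l (G + H) by apply/eigprod_ge0/posdefD.
apply: ge0_ler_powR; rewrite ?nnegrE ?powR_ge0 //.
apply: le_trans (Araki_PQ l ln); apply: ge0_ler_powR; rewrite ?nnegrE ?powR_ge0 //.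
  by rewrite mulr_ge0 // ltW.
by rewrite powR_mulrn // S1; apply: Riccati.
Qed.
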